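(* Let $n \ge 5$ be an odd number, let $\mathcal{R}=\mathbb{Z}[\tau_{ij}\mid 1\le i<j\le n]$, and let $\mathcal{T}$ be the generic $n\times n$ skew symmetric matrix over $\mathcal{R}$. The homomorphisms given by the matrices $$\partial_3 = \mathcal{T}[1\ldots n;4\ldots n],$$ $$\partial_2 = \begin{pmatrix} \operatorname{pf}(\overline{123})&0&0&-\operatorname{pf}(\overline{234})&\operatorname{pf}(\overline{235})&\cdots&\operatorname{pf}(\overline{23n})\\ 0&\operatorname{pf}(\overline{123})&0&-\operatorname{pf}(\overline{134})&\operatorname{pf}(\overline{135})&\cdots&\operatorname{pf}(\overline{13n})\\ 0&0&\operatorname{pf}(\overline{123})&-\operatorname{pf}(\overline{124})&\operatorname{pf}(\overline{125})&\cdots&\operatorname{pf}(\overline{12n})\\ \operatorname{pf}(\overline{1})&-\operatorname{pf}(\overline{2})&\operatorname{pf}(\overline{3})&-\operatorname{pf}(\overline{4})&\operatorname{pf}(\overline{5})&\cdots&\operatorname{pf}(\overline{n})\end{pmatrix}$$ (in column $j\ge4$ every entry carries the sign $(-1)^{j-1}$), and $$\partial_1 = \begin{pmatrix}-\operatorname{pf}(\overline{1})&\operatorname{pf}(\overline{2})&-\operatorname{pf}(\overline{3})&\operatorname{pf}(\overline{123})\end{pmatrix}$$ define an exact sequence $$\mathcal{F} = 0\longrightarrow \mathcal{R}^{n-3}\xrightarrow{\partial_3}\mathcal{R}^n\xrightarrow{\partial_2}\mathcal{R}^4\xrightarrow{\partial_1}\mathcal{R}.$$ That is, denoting by $\mathfrak{A}_n$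 the ideal generated by the entries of $\partial_1$, the complex $\mathcal{F}$ is a free resolution of $\mathcal{R}/\mathfrak{A}_n$. Moreover, the ideal $\mathfrak{A}_n$ is perfect of grade $3$.
   Context: $\mathcal{T}$ has entries $\mathcal{T}[i;j]=\tau_{ij}=-\mathcal{T}[j;i]$ for $1\le i<j\le n$ and zeros on the diagonal. $\mathcal{T}[1\ldots n;4\ldots n]$ is the submatrix of $\mathcal{T}$ consisting of all rows and of columns $4,\dots,n$. $\operatorname{pf}(\overline{i_1\ldots i_k})$ denotes the Pfaffian of the submatrix of $\mathcal{T}$ obtained by removing the rows and columns with indices $i_1,\dots,i_k$ (the Pfaffian of the empty matrix is $1$). Exactness is meant at $\mathcal{R}^{n-3}$, $\mathcal{R}^n$ and $\mathcal{R}^4$. *)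

(* Defs.v *)
From HB Require Import structures.
From mathcomp Require Import all_boot all_order all_algebra.
From mathcomp Require Import perm boolp mpoly.

Set Implicit Arguments.
Unset Strict Implicit.
Unset Printing Implicit Defensive.

Import GRing.Theory.
Local Open Scope ring_scope.
Local Open Scope quotient_scope.

Section IdealQuotient.

Variables (R : comNzRingType) (s : seq R).

Definition genideal : {pred R} :=
  fun x => `[< exists c : 'I_(size s) -> R, x = \sum_i c i * s`_i >].

Lemma genidealP x :
  reflect (exists c : 'I_(size s) -> R, x = \sum_i c i * s`_i) (x \in genideal).
Proof. exact: asboolP. Qed.

Lemma genideal_zmod_closed : zmod_closed genideal.
Proof.
split=> [|x y /genidealP[c ->] /genidealP[d ->]]; apply/genidealP.
  by exists (fun=> 0); rewrite big1 // => i _; rewrite mul0r.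
exists (fun i => c i - d i); rewrite -sumrB.
by apply: eq_bigr => i _; rewrite mulrBl.
Qed.

HB.instance Definition _ := GRing.isZmodClosed.Build R genideal
  genideal_zmod_closed.

Lemma genidealM a x : x \in genideal -> a * x \in genideal.
Proof.
move=> /genidealP[c ->]; apply/genidealP; exists (fun i => a * c i).
by rewrite mulr_sumr; apply: eq_bigr => i _; rewrite mulrA.
Qed.

(* Only the additive quotient is taken from ring_quotient: the quotient ring *)
(* defined there requires a proper ideal. The R-module structure is added.   *)
Definition quotmod : Type := Quotient.quot genideal.

HB.instance Definition _ := GRing.Zmodule.on quotmod.

Definition quotproj (x : R) : quotmod := \pi_(Quotient.quot genideal) x.

Definition quotscale (a : R) (u : quotmod) : quotmod :=
  quotproj (a * repr (u : Quotient.quot genideal)).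

Lemma quotproj_eq x y : (quotproj x = quotproj y) <-> (x - y \in genideal).
Proof. by rewrite Quotient.idealrBE; split=> [/eqP|/eqP]. Qed.

Lemma quotprojD x y : quotproj (x + y) = quotproj x + quotproj y.
Proof. exact: (raddfD (\pi_(Quotient.quot genideal))). Qed.

Lemma quotproj0 : quotproj 0 = 0.
Proof. exact: (raddf0 (\pi_(Quotient.quot genideal))). Qed.

Lemma quotproj_surj (u : quotmod) : exists x, quotproj x = u.
Proof. by exists (repr (u : Quotient.quot genideal)); apply: reprK. Qed.

Lemma quotscaleE a x : quotscale a (quotproj x) = quotproj (a * x).
Proof.
apply/quotproj_eq; rewrite -mulrBr; apply: genidealM; apply/quotproj_eq.
exact: reprK.
Qed.

Fact quotscaleA a b u : quotscale a (quotscale b u) = quotscale (a * b) u.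
Proof. by case: (quotproj_surj u) => x <-; rewrite !quotscaleE mulrA. Qed.

Fact quotscale1 : left_id 1 quotscale.
Proof. by move=> u; case: (quotproj_surj u) => x <-; rewrite quotscaleE mul1r. Qed.

Fact quotscaleDr : right_distributive quotscale +%R.
Proof.
move=> a u v; case: (quotproj_surj u) => x <-; case: (quotproj_surj v) => y <-.
by rewrite -quotprojD !quotscaleE mulrDr quotprojD.
Qed.

Fact quotscaleDl u : {morph quotscale^~ u : a b / a + b}.
Proof.
move=> a b; case: (quotproj_surj u) => x <-.
by rewrite !quotscaleE mulrDl quotprojD.
Qed.

HB.instance Definition _ := GRing.Zmodule_isLmodule.Build R quotmod
  quotscaleA quotscale1 quotscaleDr quotscaleDl.

Definition augmentation (v : 'cV[R]_1) : quotmod := quotproj (v 0 0).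

End IdealQuotient.

Definition exact_at (A : Type) (B C : nmodType) (f : A -> B) (g : B -> C) : Prop :=
  forall y, g y = 0 <-> exists x, f x = y.

Section Perfect.

Variable R : comNzRingType.

Definition projective (P : lmodType R) : Prop :=
  forall (M N : lmodType R) (f : {linear M -> N}) (g : {linear P -> N}),
    (forall y, exists x, f x = y) ->
    exists h : {linear P -> M}, forall x, f (h x) = g x.

Definition pdim_le (M : lmodType R) (m : nat) : Prop :=
  exists (P : nat -> lmodType R) (d : forall i, {linear P i.+1 -> P i})
         (e : {linear P 0 -> M}),
    [/\ forall i, projective (P i),
        forall i, (m < i)%N -> forall x : P i, x = 0,
        forall y, exists x, e x = y,
        exact_at (d 0) e
      & forall i, exact_at (d i.+1) (d i)].

Definition has_pdim (M : lmodType R) (m : nat) : Prop :=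
  pdim_le M m /\ forall k, pdim_le M k -> (m <= k)%N.

Definition regular_seq (s : seq R) : Prop :=
  1 \notin genideal s /\
  forall i, (i < size s)%N -> forall r,
    r * s`_i \in genideal (take i s) -> r \in genideal (take i s).

(* Maximal length of a regular sequence in I, the usual grade (depth) of a   *)
(* proper ideal I when R is Noetherian.                                      *)
Definition has_grade (I : {pred R}) (g : nat) : Prop :=
  (exists s, [/\ regular_seq s, {subset s <= I} & size s = g]) /\
  forall s, regular_seq s -> {subset s <= I} -> (size s <= g)%N.

Definition perfect_of_grade (s : seq R) (g : nat) : Prop :=
  [/\ 1 \notin genideal s, has_grade (genideal s) g & has_pdim (quotmod s) g].

End Perfect.

Section Pfaffian.

Variable R : comNzRingType.

(* The perfect matching {s 0, s 1}, {s 2, s 3}, ... written in its standard   *)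
(* form. For m even, ordS k is k + 1 at every even k; for m odd, ordS wraps   *)
(* around at k = m - 1, no s satisfies the conditions and pf is 0.            *)
Definition matching m (s : 'S_m) : bool :=
  [forall k : 'I_m, ~~ odd k ==> (s k < s (ordS k))%N] &&
  [forall k : 'I_m, forall l : 'I_m,
     [&& ~~ odd k, ~~ odd l & (k < l)%N] ==> (s k < s l)%N].

Definition pf m (A : 'M[R]_m) : R :=
  \sum_(s : 'S_m | matching s)
     (-1) ^+ s * \prod_(k < m | ~~ odd k) A (s k) (s (ordS k)).

Variables (n : nat) (A : 'M[R]_n).

(* The indices in r are numbered from 1; enum_val is increasing. *)
Definition pfbar (r : seq nat) : R :=
  let keep := [set i : 'I_n | i.+1 \notin r] in
  pf (mxsub (fun k : 'I_#|keep| => enum_val k)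
            (fun k : 'I_#|keep| => enum_val k) A).

Lemma shift3_subproof (j : 'I_(n - 3)) : (3 + j < n)%N.
Proof. by rewrite -ltn_subRL. Qed.

Definition shift3 (j : 'I_(n - 3)) : 'I_n := Ordinal (shift3_subproof j).

Definition del3 : 'M[R]_(n, n - 3) := colsub shift3 A.

Definition del2 : 'M[R]_(4, n) :=
  \matrix_(i < 4, j < n)
    let: (r, c) := (i.+1, j.+1) in
    if r == 4 then (-1) ^+ c.-1 * pfbar [:: c]
    else if (c <= 3)%N then (if r == c then pfbar [:: 1; 2; 3] else 0)
    else (-1) ^+ c.-1 * pfbar (rcons (rem r [:: 1; 2; 3]) c).

Definition del1 : 'M[R]_(1, 4) :=
  \row_(j < 4) [:: - pfbar [:: 1]; pfbar [:: 2]; - pfbar [:: 3];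
                   pfbar [:: 1; 2; 3]]`_j.

End Pfaffian.

Notation upair n := {p : 'I_n * 'I_n | (p.1 < p.2)%N}.

Notation tauring n := {mpoly int[#|{: upair n}|]}.

(* tau i j is the variable tau_ij when i < j and 0 otherwise. *)
Definition tau n (i j : 'I_n) : tauring n :=
  if insub (i, j) is Some p then 'X_(enum_rank (p : upair n)) else 0.

Definition genskew n : 'M[tauring n]_n := \matrix_(i, j) (tau i j - tau j i).

(* Main.v *)
Require Import Defs.
From HB Require Import structures.
From mathcomp Require Import all_boot all_order all_algebra.
From mathcomp Require Import finmap ring zify.
From mathcomp Require Import -(notations) monalg.
From mathcomp Require Import perm boolp mpoly.
Import GRing.Theory.
Local Open Scope ring_scope.
Set Implicit Arguments.
Unset Strict Implicit.
Unset Printing Implicit Defensive.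

(** Write u for the Pfaffian of T with rows and columns 1, 2, 3 removed, and
    p1, p2, p3 for the Pfaffians with one of these indices removed. The proof
    shows that u, p1, p2 is a regular sequence, that its first two elements
    annihilate the homology at R^n and that all three annihilate the homology at
    R^4. With the injectivity of del3, exactness follows by a diagram chase
    ([acyclic2], [acyclic1]).

    Pfaffians are handled as functions of words of indices: [pfw T w] is
    defined by expansion along the first letter of w. It is alternating
    ([pfw_swap]), vanishes when its first letter occurs again ([pfw_rep]), and
    satisfies a quadratic exchange relation ([pfw_exchange]) obtained by
    expanding one double sum in two orders. [pf_pfw] identifies it with the
    sum over perfect matchings. The composite del1 * del2 is zero by the
    exchange relation. The entries of del2 * T are zero or, up to sign, Pfaffians
    of words [:: k, i & W], with W the word of the indices 4, ..., n
    ([del2T_row], [del2T_last]); they vanish in the columns k of del3, since k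
    is then a letter of W.

    The homology is annihilated as follows. At R^n ([kill2_u],
    [kill2_p1]) a Pfaffian adjugate of the submatrix of T on an even word E
    ([word_adj]) solves T z = pf(E) y on the rows of E, and the relations
    del2 y = 0 and del2 (T z) = 0 deal with the remaining rows and coordinates.
    At R^4 ([kill1_u], [kill1_p1], [kill1_p2]) explicit preimages are
    combinations of the first three unit vectors and the first three columns of
    T ([del2_image]).

    Regularity ([regular_pfw]) is proved by induction on the number of indices,
    adding two letters at a time. If a new letter b is put in front of a word w,
    then pf(b w) is linear in each variable tau_bj, and the coefficient of this
    variable is, up to sign, the Pfaffian of w with j removed. An element linear
    in a variable that occurs nowhere else is a nonzerodivisor modulo an ideal
    as soon as its coefficient is ([nzdmod_linear]). Together with two rules for
    permuting regular sequences this turns the regularity of three maximal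
    Pfaffians on w into that of three maximal Pfaffians on a b w.

    Finally, the grade and the projective dimension both equal 3. The complex
    bounds the projective dimension from above and the regular sequence bounds
    the grade from below. The other two bounds are the inequality between the
    length of a regular sequence in the annihilator of a nonzero module and the
    length of a projective resolution ([regular_length_le_pdim]): were the
    sequence longer, the groups Ext^i(M, P_i) would vanish for all i up to the
    length of the resolution, the resolution would split, and M would be zero.
    This argument is carried out on cocycles. *)

(** * Lifting maps out of projective modules *)

Section FreeModule.

Variables (R : comNzRingType) (K : choiceType) (M : lmodType R) (v : K -> M).

Definition malg_ext (g : malg K R) : M :=
  \sum_(k <- monalg.msupp g) monalg.mcoeff k g *: v k.

Lemma malg_extEw (g : malg K R) (D : {fset K}) :
  (monalg.msupp g `<=` D)%fset ->
  malg_ext g = \sum_(k <- D) monalg.mcoeff k g *: v k.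
Proof.
move=> sgD; rewrite /malg_ext; apply: big_fset_incl => // k _ kg.
by rewrite monalg.mcoeff_outdom // scale0r.
Qed.

Lemma malg_ext_is_linear : linear malg_ext.
Proof.
move=> a g1 g2.
pose D := (monalg.msupp g1 `|` monalg.msupp g2 `|` monalg.msupp (a *: g1 + g2))%fset.
have [s1 s2 s12] : [/\ (monalg.msupp g1 `<=` D)%fset, (monalg.msupp g2 `<=` D)%fset
    & (monalg.msupp (a *: g1 + g2) `<=` D)%fset].
  by rewrite /D; split; [rewrite -fsetUA fsubsetUl | rewrite fsetUAC fsubsetUr |
                         rewrite fsubsetUr].
rewrite (malg_extEw s1) (malg_extEw s2) (malg_extEw s12).
rewrite scaler_sumr -big_split /=; apply: eq_bigr => k _.
by rewrite monalg.mcoeffD monalg.mcoeffZ scalerDl scalerA.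
Qed.

HB.instance Definition _ :=
  GRing.isLinear.Build R (malg K R) M *:%R malg_ext malg_ext_is_linear.

Lemma malg_extU k : malg_ext (mkmalgU k 1) = v k.
Proof.
by rewrite (malg_extEw msuppU_le) big_seq_fset1 monalg.mcoeffU eqxx scale1r.
Qed.

End FreeModule.

(** A projective module is a direct summand of the free module on its own
    underlying set; this gives access to coordinates. *)
Lemma projective_section (R : comNzRingType) (P : lmodType R) :
  projective P ->
  exists s : {linear P -> malg P R}, forall p, malg_ext id (s p) = p.
Proof.
move=> /(_ _ _ (malg_ext (@id P)) idfun); apply=> y.
by exists (mkmalgU y 1); rewrite /= malg_extU.
Qed.

(** Unlike in the definition of projectivity, f need not be onto: only the image
    of g has to be covered. The lift is defined on the basis of a free module of
    which P is a summand. *)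
Lemma projective_lift (R : comNzRingType) (P M N : lmodType R)
    (f : {linear M -> N}) (g : {linear P -> N}) :
  projective P -> (forall p, exists m, f m = g p) ->
  exists h : {linear P -> M}, forall p, f (h p) = g p.
Proof.
move=> /projective_section[s sK] /choice[v fv].
exists (malg_ext v \o s : {linear P -> M}) => p /=.
rewrite -{2}[p]sK !linear_sum; apply: eq_bigr => k _.
by rewrite !linearZ_LR fv.
Qed.

Lemma projective_cV (R : comNzRingType) m : projective ('cV[R]_m : lmodType R).
Proof.
move=> M N f g fsurj.
have /choice[v fv] : forall i : 'I_m, exists x, f x = g (delta_mx i 0).
  by move=> i; apply: fsurj.
pose h (y : 'cV[R]_m) := \sum_i y i 0 *: v i.
have h_lin : linear h.
  move=> a y z; rewrite /h scaler_sumr -big_split /=; apply: eq_bigr => i _.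
  by rewrite !mxE scalerDl scalerA.
pose hl := GRing.isLinear.Build R 'cV[R]_m M *:%R h h_lin.
exists (HB.pack_for {linear 'cV[R]_m -> M} h hl) => y /=.
rewrite /h linear_sum {2}(matrix_sum_delta y) linear_sum.
apply: eq_bigr => i _; rewrite big_ord1 linearZ_LR fv -linearZ_LR.
by [].
Qed.

(** * Regular sequences and the length of projective resolutions *)

Section RegularModule.

Variables (R : comNzRingType) (x : nat -> R).

Definition in_multiples (N : lmodType R) (j : nat) (y : N) : Prop :=
  exists c : nat -> N, y = \sum_(l < j) x l *: c l.

Lemma in_multiples_eq0 (N : lmodType R) (y : N) : in_multiples 0 y -> y = 0.
Proof. by case=> c ->; rewrite big_ord0. Qed.

Lemma in_multiples0 (N : lmodType R) j : in_multiples j (0 : N).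
Proof. by exists (fun=> 0); rewrite big1 // => i _; rewrite scaler0. Qed.

Lemma in_multiplesD (N : lmodType R) j (y z : N) :
  in_multiples j y -> in_multiples j z -> in_multiples j (y + z).
Proof.
case=> c -> [d ->]; exists (fun l => c l + d l).
by rewrite -big_split; apply: eq_bigr => l _; rewrite scalerDr.
Qed.

Lemma in_multiplesN (N : lmodType R) j (y : N) :
  in_multiples j y -> in_multiples j (- y).
Proof.
case=> c ->; exists (fun l => - c l).
by rewrite -sumrN; apply: eq_bigr => l _; rewrite scalerN.
Qed.

Lemma in_multiplesS (N : lmodType R) j (y z : N) :
  in_multiples j y -> in_multiples j.+1 (x j *: z + y).
Proof.
case=> c ->; exists (fun l => if l == j then z else c l).
rewrite big_ord_recr /= eqxx addrC; congr (_ + _); apply: eq_bigr => l _.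
by rewrite (ltn_eqF (ltn_ord l)).
Qed.

(** The coefficients of a map into the submodule (x_0, ..., x_(j-1)) N can be chosen linearly,
    because the domain is projective. *)
Lemma projective_multiples (P N : lmodType R) (f : {linear P -> N}) j :
    projective P -> (forall p, in_multiples j (f p)) ->
  exists c : {linear P -> {ffun 'I_j -> N}},
    forall p, f p = \sum_(l < j) x l *: c p l.
Proof.
move=> prP fJ; pose ev (c : {ffun 'I_j -> N}) : N := \sum_(l < j) x l *: c l.
have ev_lin : linear ev.
  move=> a y z; rewrite /ev scaler_sumr -big_split /=; apply: eq_bigr => i _.
  by rewrite !ffunE scalerDr !scalerA mulrC.
pose evl := GRing.isLinear.Build R {ffun 'I_j -> N} N *:%R ev ev_lin.
pose ev' := HB.pack_for {linear {ffun 'I_j -> N} -> N} ev evl.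
have [|c cP] := @projective_lift _ _ _ _ ev' f prP.
  move=> p; have [c ->] := fJ p; exists [ffun l : 'I_j => c l].
  by apply: eq_bigr => l _; rewrite ffunE.
by exists c => p; rewrite -cP.
Qed.

Variable g : nat.
Hypothesis x_reg : forall i, (i < g)%N ->
  forall r : R^o, in_multiples i (x i *: r) -> in_multiples i r.

(** Regularity passes to free modules coordinatewise, hence to their summands. *)
Lemma projective_regular (P : lmodType R) i (p : P) :
  projective P -> (i < g)%N -> in_multiples i (x i *: p) -> in_multiples i p.
Proof.
move=> /projective_section[s sK] ltig xpJ; rewrite -[p]sK.
have coefJ k : in_multiples i (monalg.mcoeff k (s p) : R^o).
  apply: x_reg => //; have [c /(congr1 s)] := xpJ.
  rewrite linearZ_LR => /(congr1 (monalg.mcoeff k)).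
  rewrite monalg.mcoeffZ linear_sum raddf_sum => xcoefE.
  exists (fun l => monalg.mcoeff k (s (c l))); rewrite [LHS]xcoefE /=.
  by apply: eq_bigr => l _; rewrite linearZ_LR monalg.mcoeffZ.
rewrite /malg_ext; elim/big_ind: _ => [|y z|k _]; first exact: in_multiples0.
  exact: in_multiplesD.
have [c ->] := coefJ k; exists (fun l => c l *: k).
by rewrite scaler_suml; apply: eq_bigr => l _; rewrite scalerA.
Qed.

Section Resolution.

Variables (M : lmodType R) (P : nat -> lmodType R).
Variables (d : forall i, {linear P i.+1 -> P i}) (e : {linear P 0 -> M}).
Arguments d : clear implicits.
Hypotheses (P_proj : forall i, projective (P i))
  (e_surj : forall y, exists p, e p = y)
  (exact0 : exact_at (d 0%N) e) (exactS : forall i, exact_at (d i.+1) (d i)).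

Lemma resolution_dd i p : d i (d i.+1 p) = 0.
Proof. by apply/exactS; exists p. Qed.

Lemma homotopy0 a : (forall y : M, a *: y = 0) ->
  exists h : {linear P 0 -> P 1%N}, forall p, d 0%N (h p) = a *: p.
Proof.
move=> aM0; have [|h hP] := @projective_lift _ _ _ _ (d 0%N) (a \*: idfun) (@P_proj 0%N).
  by move=> p /=; apply/exact0; rewrite linearZ_LR aM0.
by exists h => p; rewrite hP.
Qed.

(** Multiplication by an element that kills M lifts the zero map of M to the
    resolution, so it is homotopic to zero there. *)
Lemma homotopyS a : (forall y : M, a *: y = 0) ->
  forall i, exists (h : {linear P i -> P i.+1}) (h' : {linear P i.+1 -> P i.+2}),
    forall p, d i.+1 (h' p) + h (d i p) = a *: p.
Proof.
move=> aM0 i.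
have step j (h : {linear P j -> P j.+1}) :
    (forall p, d j (h (d j p)) = a *: d j p) ->
    exists h' : {linear P j.+1 -> P j.+2},
      forall p, d j.+1 (h' p) + h (d j p) = a *: p.
  move=> hP.
  have [|h' h'P] := @projective_lift _ _ _ _ (d j.+1)
      ((a \*: idfun) \- (h \o d j)) (@P_proj j.+1).
    by move=> p /=; apply/exactS; rewrite linearB /= linearZ_LR hP subrr.
  by exists h' => p; rewrite h'P /= subrK.
elim: i => [|i [h [h' hh']]].
  have [h hP] := homotopy0 aM0; have [|h' h'P] := step _ h.
    by move=> p; rewrite hP.
  by exists h, h'.
have [|h'' h''P] := step _ h'; last by exists h', h''.
by move=> p; have := hh' (d i.+1 p); rewrite resolution_dd raddf0 addr0.
Qed.

(** In degree 0 the only coboundary is zero. *)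
Definition coboundary (N : lmodType R) i : {linear P i -> N} -> Prop :=
  if i is i'.+1 return {linear P i -> N} -> Prop then
    fun t => exists u : {linear P i' -> N}, forall p, t p = u (d i' p)
  else fun t => forall p, t p = 0.

Lemma coboundary_d (N : lmodType R) i (t : {linear P i -> N}) p :
  coboundary t -> t (d i p) = 0.
Proof.
case: i t p => [|i] t p /= => [-> //|[u ->]].
by rewrite resolution_dd raddf0.
Qed.

Hypothesis xM0 : forall i, (i < g)%N -> forall y : M, x i *: y = 0.

(** Vanishing of Ext^i(M, N / (x_0, ..., x_(j-1)) N) for i + j < g, expressed
    with maps into N. Since x_j acts as zero on this group and is regular on the
    quotient of N, the group is a quotient of the one for i - 1 and j + 1. *)
Lemma cocycle_coboundary (N : lmodType R) i j (f : {linear P i -> N}) :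
    projective N -> (i + j < g)%N -> (forall p, in_multiples j (f (d i p))) ->
  exists2 t : {linear P i -> N}, coboundary t & forall p, in_multiples j (f p - t p).
Proof.
move=> prN; elim: i j f => [|i IHi] j f ltg fJ.
  exists \0 => [//|p /=]; rewrite subr0; apply: projective_regular => //.
  have [h hP] := homotopy0 (xM0 ltg).
  by rewrite -linearZ_LR -hP.
have ltjg : (j < g)%N by apply: leq_ltn_trans ltg; rewrite leq_addl.
have [h [h' hP]] := homotopyS (xM0 ltjg) i.
(* As f is a cocycle, the homotopy gives x_j f = f h d modulo the first j
   elements: f \o h is a cocycle one degree lower, modulo one more element. *)
have fhJ p : in_multiples j.+1 ((f \o h) (d i p)).
  have -> : (f \o h) (d i p) = x j *: f p + - f (d i.+1 (h' p)).
    by rewrite -linearZ_LR -hP raddfD addrAC subrr add0r.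
  exact/in_multiplesS/in_multiplesN.
have [|t tcob tJ] := IHi j.+1 (f \o h) _ fhJ; first by rewrite addnS.
have [c cP] := projective_multiples (f := (f \o h) \- t) (@P_proj i) tJ.
have u_lin : linear (fun p => c p ord_max).
  by move=> a p q; rewrite linearP !ffunE.
pose ul := GRing.isLinear.Build R (P i) N *:%R (fun p => c p ord_max) u_lin.
pose u := HB.pack_for {linear P i -> N} (fun p => c p ord_max) ul.
exists (u \o d i : {linear P i.+1 -> N}); first by exists u.
move=> p; apply: projective_regular => //.
have -> : x j *: (f p - (u \o d i) p) =
    f (d i.+1 (h' p)) + (f (h (d i p)) - x j *: u (d i p)).
  by rewrite scalerBr -linearZ_LR -hP raddfD addrA.
apply: in_multiplesD => //; have := cP (d i p); rewrite /= (coboundary_d _ tcob) subr0.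
move=> ->; rewrite big_ord_recr /= addrK.
exists (fun l => if insub l is Some l' then c (d i p) l' else 0).
apply: eq_bigr => l _; rewrite insubT ?ltnS 1?ltnW // => ltl /=.
by congr (_ *: c _ _); apply: val_inj.
Qed.

(** If the resolution were shorter than the regular sequence, the identity of
    each P_i, corrected by the part of a contracting homotopy built in higher
    degrees, would be a cocycle with values in the projective module P_i and so
    a coboundary. The contraction would extend down to degree 0, and d_0 would
    be onto. *)
Lemma regular_length_le_pdim k :
  (exists y : M, y <> 0) -> (forall i, (k < i)%N -> forall p : P i, p = 0) ->
  (g <= k)%N.
Proof.
move=> [y0 y0n0] Pk0; rewrite leqNgt; apply/negP => ltkg.
have split_d i : exists s : {linear P i -> P i.+1},
    forall p, d i (s (d i p)) = d i p.
  have [n] := ubnP (k - i); elim: n i => [|n IHn] i; first by rewrite ltn0.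
  rewrite ltnS => lekin; have [leki|ltik] := leqP k i.
    by exists \0 => p; rewrite (Pk0 _ _ p) ?raddf0 // ltnS.
  have [|s sP] := IHn i.+1.
    by rewrite subnS prednK ?subn_gt0 // (leq_trans _ lekin).
  have [|||t [u tu] tJ] := @cocycle_coboundary _ i.+1 0 (idfun \- (d i.+1 \o s)).
  - exact: P_proj.
  - by rewrite addn0 (leq_ltn_trans ltik).
  - by move=> p /=; rewrite sP subrr; apply: in_multiples0.
  exists u => p; have /in_multiples_eq0 := tJ p; rewrite tu /= => /eqP; rewrite subr_eq0.
  by move=> /eqP <-; rewrite raddfB /= resolution_dd subr0.
have [s sP] := split_d 0%N.
have [|||t t0 tJ] := @cocycle_coboundary _ 0 0 (idfun \- (d 0%N \o s)).
- exact: P_proj.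
- by rewrite (leq_trans _ ltkg).
- by move=> p /=; rewrite sP subrr; apply: in_multiples0.
case: y0n0; have [p <-] := e_surj y0.
have /in_multiples_eq0 := tJ p; rewrite t0 subr0 /= => /eqP; rewrite subr_eq0 => /eqP ->.
by apply/exact0; exists (s p).
Qed.

End Resolution.
End RegularModule.

(** * Pfaffians of words *)

Section Deletion.

Variable I : eqType.
Implicit Types (w x y : seq I).

Definition omit k w := take k w ++ drop k.+1 w.

Lemma size_omit k w : (k < size w)%N -> size (omit k w) = (size w).-1.
Proof. by move=> ltkw; rewrite size_cat size_drop size_takel ?(ltnW ltkw) //; lia. Qed.

Lemma nth_omit (x0 : I) k w l : (k < size w)%N ->
  nth x0 (omit k w) l = nth x0 w (bump k l).
Proof.
move=> ltkw; rewrite nth_cat size_takel ?(ltnW ltkw) // /bump.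
have [ltlk|lekl] := ltnP l k; first by rewrite nth_take ?add0n.
by rewrite nth_drop; congr nth; lia.
Qed.

Lemma omit0 a w : omit 0 (a :: w) = w.
Proof. by rewrite /omit /= drop0. Qed.

Lemma omitS a k w : omit k.+1 (a :: w) = a :: omit k w.
Proof. by []. Qed.

Lemma omit_catl k x y : (k < size x)%N -> omit k (x ++ y) = omit k x ++ y.
Proof.
elim: x k => [|a x IHx] [|k] //=; rewrite ?omit0 // ltnS => ltkx.
by rewrite !omitS IHx.
Qed.

Lemma omit_catr k x y : omit (size x + k) (x ++ y) = x ++ omit k y.
Proof. by elim: x => [|a x IHx] //=; rewrite omitS IHx. Qed.

Lemma omit_omit k l w : (k <= l)%N -> omit l (omit k w) = omit k (omit l.+1 w).
Proof.
elim: w k l => [|a w IHw] // [|k] [|l] //; first by rewrite omitS !omit0.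
  by rewrite omitS !omit0.
by rewrite ltnS => lekl; rewrite !omitS IHw.
Qed.

Lemma mem_omit k w a : uniq w -> (k < size w)%N ->
  (a \in omit k w) = (a != nth a w k) && (a \in w).
Proof.
elim: w k => [|b w IHw] [|k] //= /andP[bw uw] ltkw; rewrite inE.
  rewrite omit0; case: eqVneq => //= ->; exact: negbTE.
rewrite omitS inE IHw //; case: (eqVneq a b) => //= ->; rewrite ?orbF andbT.
by symmetry; apply: contraNneq bw => {1}->; rewrite mem_nth.
Qed.

Lemma omit_subset k w : {subset omit k w <= w}.
Proof.
by move=> a; rewrite mem_cat => /orP[/mem_take|/mem_drop].
Qed.

End Deletion.

Section DoubleSum.
Variable V : nmodType.

(** Choosing positions k, then l in what is left, amounts to choosing an
    unordered pair of positions together with an order on it. *)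
Lemma sum_delete2 (m : nat) (f : nat -> nat -> V) :
  \sum_(k < m.+1) \sum_(l < m) f k l =
  \sum_(k < m) \sum_(l < m | (k <= l)%N) (f k l + f l.+1 k).
Proof.
transitivity (\sum_(k < m.+1) \sum_(l < m | (k <= l)%N) f k l +
              \sum_(k < m.+1) \sum_(l < m | (l < k)%N) f k l).
  rewrite -big_split /=; apply: eq_bigr => k _.
  rewrite (bigID (fun l : 'I_m => (k <= l)%N)) /=; congr (_ + _).
  by apply: eq_bigl => l; rewrite ltnNge.
rewrite big_ord_recr /= [X in _ + X + _]big1 ?addr0; last first.
  by move=> l; rewrite leqNgt ltn_ord.
rewrite [X in _ + X](_ : _ = \sum_(k < m) \sum_(l < m | (k <= l)%N) f l.+1 k).
  rewrite -big_split /=; apply: eq_bigr => k _; rewrite -big_split /=.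
  by apply: eq_bigr.
under eq_bigr do rewrite big_mkcond.
rewrite exchange_big /=; apply: eq_bigr => l _.
rewrite big_ord_recl /= add0r [RHS]big_mkcond.
by apply: eq_bigr => k _; rewrite /bump add1n ltnS.
Qed.
End DoubleSum.

Section WordPfaffian.

Variables (R : comNzRingType) (I : eqType) (T : I -> I -> R).
Implicit Types (w x y : seq I) (a b c : I).

(** The number m bounds the depth of the recursion, which removes two letters at
    each step. *)
Fixpoint pfw_rec m w : R :=
  match m, w with
  | _, [::] => 1
  | m'.+1, a :: w' =>
    \sum_(k < size w') (-1) ^+ k * (T a (nth a w' k) * pfw_rec m' (omit k w'))
  | 0, _ => 0
  end.

Definition pfw w := pfw_rec (size w) w.

Lemma pfw_nil : pfw [::] = 1. Proof. by []. Qed.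

Lemma pfw_recE m w : (size w <= m)%N -> pfw_rec m w = pfw w.
Proof.
rewrite /pfw; have [n] := ubnP (size w).
elim: n w m => [|n IHn] // [|a w] [|m] //=; rewrite !ltnS => lewn lewm.
apply: eq_bigr => k _; have szd := size_omit (ltn_ord k).
rewrite IHn ?szd; try lia; rewrite [in RHS]IHn ?szd //; lia.
Qed.

Lemma pfw_cons (x0 : I) a w : pfw (a :: w) =
  \sum_(k < size w) (-1) ^+ k * (T a (nth x0 w k) * pfw (omit k w)).
Proof.
rewrite {1}/pfw /=; apply: eq_bigr => k _; rewrite (set_nth_default x0) //.
by rewrite pfw_recE // size_omit //; lia.
Qed.

Lemma pfw_cons_split (x0 : I) a w i : (i < size w)%N ->
  pfw (a :: w) = T a (nth x0 w i) * ((-1) ^+ i * pfw (omit i w)) +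
    \sum_(k < size w | k != i :> nat)
       (-1) ^+ k * (T a (nth x0 w k) * pfw (omit k w)).
Proof.
move=> ltiw; rewrite (pfw_cons x0) (bigD1 (Ordinal ltiw)) //= mulrCA.
by congr (_ + _).
Qed.

(** The sum on the right is expanded once more, along b, in [pfw_expand2]; there
    its antisymmetry in a and b becomes visible. *)
Lemma pfw_cons2 (x0 : I) a b w : pfw (a :: b :: w) =
  T a b * pfw w -
  \sum_(k < size w) (-1) ^+ k * (T a (nth x0 w k) * pfw (b :: omit k w)).
Proof.
rewrite (pfw_cons x0) /= big_ord_recl /= omit0 expr0 mul1r; congr (_ + _).
rewrite -sumrN; apply: eq_bigr => k _.
by rewrite /bump add1n /= omitS exprS -mulrA mulN1r.
Qed.

Hypotheses (T_skew : forall a b, T b a = - T a b) (T_diag : forall a, T a a = 0).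

Lemma pfw_expand2 (x0 : I) a b w m : size w = m.+1 ->
  \sum_(k < size w) (-1) ^+ k * (T a (nth x0 w k) * pfw (b :: omit k w)) =
  \sum_(k < m) \sum_(l < m | (k <= l)%N) (-1) ^+ (k + l) *
    ((T a (nth x0 w k) * T b (nth x0 w l.+1) -
      T a (nth x0 w l.+1) * T b (nth x0 w k)) * pfw (omit k (omit l.+1 w))).
Proof.
move=> szw; pose f k l := (-1) ^+ (k + l) * (T a (nth x0 w k) *
  T b (nth x0 w (bump k l)) * pfw (omit l (omit k w))).
transitivity (\sum_(k < m.+1) \sum_(l < m) f k l).
  rewrite szw; apply: eq_bigr => k _; rewrite (pfw_cons x0).
  have ltkw : (k < size w)%N by rewrite szw.
  rewrite size_omit // szw !mulr_sumr; apply: eq_bigr => l _.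
  by rewrite nth_omit // /f exprD; ring.
rewrite sum_delete2; apply: eq_bigr => k _; apply: eq_bigr => l lekl.
rewrite /f /bump lekl ltnNge lekl /= add0n add1n omit_omit //.
by rewrite addSn exprS (addnC l); ring.
Qed.

Lemma pfw_swap_front a b w : pfw (a :: b :: w) = - pfw (b :: a :: w).
Proof.
rewrite !(pfw_cons2 a) (T_skew a b) mulNr opprD !opprK.
case szw: (size w) => [|m]; first by rewrite !big_ord0 oppr0 addr0.
rewrite -szw !(@pfw_expand2 a _ _ _ m) //; congr (_ + _).
rewrite -sumrN; apply: eq_bigr => k _; rewrite -sumrN; apply: eq_bigr => l _.
by ring.
Qed.

Lemma pfw_rep_front a w : pfw (a :: a :: w) = 0.
Proof.
rewrite (pfw_cons2 a) T_diag mul0r add0r.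
case szw: (size w) => [|m]; first by rewrite big_ord0 oppr0.
rewrite -szw (@pfw_expand2 a _ _ _ m) // big1 ?oppr0 // => k _.
by rewrite big1 // => l _; ring.
Qed.

Lemma pfw_swap x a b y : pfw (x ++ a :: b :: y) = - pfw (x ++ b :: a :: y).
Proof.
have [n] := ubnP (size x); elim: n x y => // n IHn [|c x] y /=.
  by move=> _; apply: pfw_swap_front.
rewrite ltnS => lexn; rewrite !(pfw_cons c).
have sum_cat z (F : nat -> R) : \sum_(k < size (x ++ z)) F k =
    \sum_(k < size x) F k + \sum_(k < size z) F (size x + k)%N :> R.
  by rewrite size_cat big_split_ord.
pose F z k := (-1) ^+ k * (T c (nth c (x ++ z) k) * pfw (omit k (x ++ z))).
rewrite (sum_cat _ (F [:: a, b & y])) (sum_cat _ (F [:: b, a & y])) {}/F opprD.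
congr (_ + _).
  rewrite -sumrN; apply: eq_bigr => k _.
  rewrite !nth_cat ltn_ord !omit_catl // IHn; first by ring.
  by rewrite size_omit //; have := ltn_ord k; lia.
rewrite /= !big_ord_recl /= !addrA opprD; congr (_ + _).
  rewrite !nth_cat !omit_catr /= /bump /= !add1n addn0 ltnn subnn /=.
  by rewrite ltnNge leq_addr /= addKn /= addn1 exprS !omitS !omit0; ring.
rewrite -sumrN; apply: eq_bigr => k _.
rewrite /bump /= !add1n !omit_catr !nth_cat ltnNge leq_addr /= addKn /=.
rewrite IHn; [|lia].
by ring.
Qed.

Lemma pfw_move x a w y :
  pfw (x ++ a :: w ++ y) = (-1) ^+ size w * pfw (x ++ w ++ a :: y).
Proof.
elim: w x => [|b w IHw] x /=; first by rewrite mul1r.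
by rewrite pfw_swap -cat_rcons IHw cat_rcons exprS mulN1r mulNr.
Qed.

Lemma pfw_rep a w : a \in w -> pfw (a :: w) = 0.
Proof.
move=> aw; rewrite -(cat_take_drop (index a w) w) (drop_nth a) ?index_mem //.
rewrite nth_index //.
set x := take _ _; set y := drop _ _.
have := pfw_move [:: a] a x y; rewrite /= pfw_rep_front => /esym/eqP.
by rewrite mulrI_eq0 => [/eqP//|]; apply: lreg_sign.
Qed.

Lemma pfw_insert (x0 : I) w k : (k < size w)%N ->
  pfw (nth x0 w k :: omit k w) = (-1) ^+ k * pfw w.
Proof.
move=> ltkw; have := pfw_move [::] (nth x0 w k) (take k w) (drop k.+1 w).
by rewrite /= size_takel ?(ltnW ltkw) // -drop_nth // cat_take_drop.
Qed.

(** Expanding the second factors along their first letters gives the same sum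
    over pairs (x_i, y_j) twice, with opposite signs because T is skew. When
    most letters are common to x and y, [pfw_rep] leaves a short quadratic
    relation between Pfaffians. *)
Lemma pfw_exchange (x0 : I) x y :
  \sum_(i < size x) (-1) ^+ i * (pfw (omit i x) * pfw (nth x0 x i :: y)) +
  \sum_(j < size y) (-1) ^+ j * (pfw (omit j y) * pfw (nth x0 y j :: x)) = 0.
Proof.
under eq_bigr do rewrite (pfw_cons x0) mulr_sumr mulr_sumr.
under [X in _ + X]eq_bigr do rewrite (pfw_cons x0) mulr_sumr mulr_sumr.
rewrite exchange_big -big_split big1 //= => j _; rewrite -big_split big1 //=.
by move=> i _; rewrite (T_skew (nth x0 x i)); ring.
Qed.

End WordPfaffian.

(** * Expansion of the sum over perfect matchings *)

Section PfaffianExpansion.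

Variable R : comNzRingType.

Definition lift2 m (k : 'I_m.+1) (i : 'I_m) : 'I_m.+2 := lift ord0 (lift k i).

(** The matching that joins 0 to k + 1 and restricts to the matching s on the
    other points. *)
Definition lift_matching m (k : 'I_m.+1) (s : 'S_m) : 'S_m.+2 :=
  lift_perm ord0 ord0 (lift_perm ord0 k s).

Definition ord_one m : 'I_m.+2 := lift ord0 ord0.

Lemma lift_matching0 m k (s : 'S_m) : lift_matching k s ord0 = ord0.
Proof. exact: lift_perm_id. Qed.

Lemma lift_matching1 m k (s : 'S_m) : lift_matching k s (ord_one m) = lift ord0 k.
Proof. by rewrite lift_perm_lift lift_perm_id. Qed.

Lemma lift_matching2 m k (s : 'S_m) i :
  lift_matching k s (lift ord0 (lift ord0 i)) = lift2 k (s i).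
Proof. by rewrite !lift_perm_lift. Qed.

Lemma ordS0 m : ordS (ord0 : 'I_m.+2) = ord_one m.
Proof. by apply: val_inj. Qed.

(** Parity of m keeps the successor of an even point from wrapping around. *)
Lemma ordS2 m (i : 'I_m) : ~~ odd m -> ~~ odd i ->
  ordS (lift ord0 (lift ord0 i) : 'I_m.+2) = lift ord0 (lift ord0 (ordS i)).
Proof.
move=> m_even i_even; apply: val_inj => /=; rewrite /bump /= !add1n.
have := ltn_ord i; rewrite leq_eqVlt => /predU1P[mE|ltim].
  have : ~~ odd i.+1 by rewrite mE.
  by rewrite /= i_even.
by rewrite !modn_small.
Qed.

Lemma ltn_lift2 m (k : 'I_m.+1) (i j : 'I_m) :
  (lift2 k i < lift2 k j)%N = (i < j)%N.
Proof. rewrite /= /bump; lia. Qed.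

Lemma odd_lift0 m (i : 'I_m) : odd (lift ord0 (lift ord0 i) : 'I_m.+2) = odd i.
Proof. by rewrite !lift0 /= negbK. Qed.

Lemma ltn_lift0 m (i j : 'I_m) :
  ((lift ord0 (lift ord0 i) : 'I_m.+2) < lift ord0 (lift ord0 j))%N = (i < j)%N.
Proof. by rewrite !lift0. Qed.

Lemma matching_lift m k (s : 'S_m) : ~~ odd m ->
  matching (lift_matching k s) = matching s.
Proof.
move=> m_even; apply/andP/andP => -[/forallP s1 /forallP s2]; split.
- apply/forallP => i; apply/implyP => i_even.
  have := s1 (lift ord0 (lift ord0 i)); rewrite odd_lift0 i_even /= ordS2 //.
  by rewrite !lift_matching2 ltn_lift2.
- apply/forallP => i; apply/forallP => j.
  have := forallP (s2 (lift ord0 (lift ord0 i))) (lift ord0 (lift ord0 j)).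
  by rewrite !lift_matching2 ltn_lift2 !odd_lift0 ltn_lift0.
- apply/forallP => i; case: (unliftP ord0 i) => [i1 ->|->]; last first.
    by rewrite ordS0 lift_matching0 lift_matching1 lift0 implybT.
  case: (unliftP ord0 i1) => [i2 ->|->]; last by [].
  rewrite odd_lift0; apply/implyP => i_even.
  by rewrite ordS2 // !lift_matching2 ltn_lift2; apply: (implyP (s1 i2)).
- apply/forallP => i; apply/forallP => j.
  case: (unliftP ord0 j) => [j1 ->|->]; last by rewrite ltn0 !andbF.
  case: (unliftP ord0 j1) => [j2 ->|->]; last by rewrite /= andbF.
  case: (unliftP ord0 i) => [i1 ->|->]; last first.
    by rewrite lift_matching0 lift_matching2 /lift2 lift0 implybT.
  case: (unliftP ord0 i1) => [i2 ->|->]; last by [].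
  rewrite !lift_matching2 ltn_lift2 !odd_lift0 ltn_lift0.
  exact: (forallP (s2 i2)).
Qed.

(** The first points of the pairs increase and every pair is increasing, so the
    smallest point comes first. *)
Lemma matching_fix0 m (s : 'S_m.+2) : ~~ odd m -> matching s -> s ord0 = ord0.
Proof.
move=> m_even /andP[/forallP s1 /forallP s2].
have lt0 (i : 'I_m.+2) : i != ord0 -> (s ord0 < s i)%N.
  have even_lt (j : 'I_m.+2) : ~~ odd j -> j != ord0 -> (s ord0 < s j)%N.
    move=> j_even j0; have := forallP (s2 ord0) j; rewrite j_even /= lt0n.
    by rewrite -[(_ != 0)%N]/(j != ord0) j0.
  move=> i0; have [i_odd|i_even] := boolP (odd i); last exact: even_lt.
  have ltj : (i.-1 < m.+2)%N by apply: leq_ltn_trans (ltn_ord i); rewrite leq_pred.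
  pose j := Ordinal ltj; have i_gt0 : (0 < i)%N by rewrite lt0n.
  have j_even : ~~ odd j by rewrite /=; case: (nat_of_ord i) i_gt0 i_odd.
  have iE : i = ordS j.
    by apply: val_inj; rewrite /= prednK // modn_small.
  have := s1 j; rewrite j_even -iE /= => ltji.
  have [->//|j0] := eqVneq ord0 j.
  by apply: ltn_trans ltji; apply: even_lt; rewrite // eq_sym.
have [s0E|/lt0] := eqVneq ((s^-1)%g ord0) ord0; last by rewrite permKV ltn0.
by rewrite -{1}s0E permKV.
Qed.

Lemma lift_perm_surj m i j (s : 'S_m.+1) : s i = j ->
  exists t, s = lift_perm i j t.
Proof.
move=> sij; pose f k := odflt k (unlift j (s (lift i k))).
have fE k : lift j (f k) = s (lift i k).
  rewrite /f; case: unliftP => [//|/eqP].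
  by rewrite -sij (inj_eq perm_inj) eq_sym (negbTE (neq_lift _ _)).
have f_inj : injective f.
  by move=> k l fkl; apply: (@lift_inj _ i); apply: (@perm_inj _ s); rewrite -!fE fkl.
exists (perm f_inj); apply/permP => k; case: (unliftP i k) => [l ->|->].
  by rewrite lift_perm_lift permE fE.
by rewrite lift_perm_id.
Qed.

Lemma lift_perm_inj m i j : injective (@lift_perm m i j).
Proof.
move=> s t st; apply/permP => k; apply: (@lift_inj _ j).
by rewrite -(lift_perm_lift i j s) st lift_perm_lift.
Qed.

(** A matching is determined by the partner of 0 and by its restriction to the
    remaining points. *)
Lemma pf_expand m (A : 'M[R]_m.+2) : ~~ odd m ->
  pf A = \sum_(k < m.+1) (-1) ^+ k *
    (A ord0 (lift ord0 k) * pf (mxsub (lift2 k) (lift2 k) A)).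
Proof.
move=> m_even; rewrite /pf.
pose h (p : 'I_m.+1 * 'S_m) := lift_matching p.1 p.2.
have h_inj : injective h.
  move=> [k s] [l t] hE.
  have kl : k = l.
    apply: (@lift_inj _ ord0); rewrite -(lift_matching1 k s) -(lift_matching1 l t).
    by rewrite [LHS](congr1 (fun u : 'S__ => u _) hE).
  by move: hE; rewrite /h kl /= => /lift_perm_inj/lift_perm_inj ->.
pose h' s := odflt (ord0, 1%g) [pick p | h p == s].
have hK p : h' (h p) = p.
  rewrite /h'; case: pickP => [q /eqP/h_inj //|/(_ p)]; by rewrite eqxx.
rewrite (reindex_onto h h') /=; last first.
  move=> s /(matching_fix0 m_even) s00.
  have [t sE] := lift_perm_surj s00; have [u tE] := lift_perm_surj (erefl (t ord0)).
  have -> : s = h (t ord0, u) by rewrite sE {1}tE.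
  by rewrite hK.
rewrite (eq_bigl (fun p => matching p.2)); last first.
  by move=> p; rewrite hK eqxx andbT matching_lift.
rewrite -(pair_big_dep xpredT (fun _ s => matching s) (fun k s =>
  (-1) ^+ lift_matching k s * \prod_(i < m.+2 | ~~ odd i)
     A (lift_matching k s i) (lift_matching k s (ordS i)))) /=.
apply: eq_bigr => k _; rewrite !mulr_sumr; apply: eq_bigr => s _.
rewrite !odd_lift_perm /= big_mkcond !big_ord_recl /= mul1r.
rewrite ordS0 lift_matching0 lift_matching1.
rewrite [X in _ * (_ * X)](_ : _ = \prod_(i < m | ~~ odd i)
   mxsub (lift2 k) (lift2 k) A (s i) (s (ordS i))); last first.
  rewrite [RHS]big_mkcond; apply: eq_bigr => i _; rewrite /= add0n !negbK.
  by case: ifPn => // i_even; rewrite ordS2 // !lift_matching2 mxE.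
by rewrite signr_addb signr_odd -mulrA [X in _ * X = _]mulrCA.
Qed.

Lemma pf_pfw (I : eqType) (T : I -> I -> R) m (f : 'I_m -> I) : ~~ odd m ->
  pf (\matrix_(i, j) T (f i) (f j)) = pfw T [seq f i | i <- enum 'I_m].
Proof.
have [n] := ubnP m; elim: n m f => // n IHn [|[|m]] f //.
  move=> _ _; rewrite /pf enum_ord0 /= pfw_nil (bigD1 (1 : 'S_0)%g) /=; last first.
    by apply/andP; split; apply/forallP; case.
  rewrite big_ord0 odd_perm1 mul1r big1 ?addr0 // => s /andP[_ /eqP[]].
  by apply/permP; case.
rewrite /= negbK !ltnS => lemn m_even.
rewrite pf_expand // enum_ordSl /= (pfw_cons _ (f ord0)) !size_map -enumT size_enum_ord.
apply: eq_bigr => k _; rewrite !mxE; congr (_ * (_ * _)).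
  congr (T _ _); rewrite -map_comp (nth_map k) ?size_enum_ord //.
  by rewrite nth_ord_enum.
rewrite (_ : mxsub _ _ _ = \matrix_(i, j) T (f (lift2 k i)) (f (lift2 k j))); last first.
  by apply/matrixP => i j; rewrite !mxE.
rewrite IHn // 1?ltnW //; congr pfw; apply: (@eq_from_nth _ (f ord0)).
  by rewrite size_omit !size_map -?enumT !size_enum_ord /=.
rewrite size_map size_enum_ord => i ltim.
have ltkm : (k < size [seq f i | i <- [seq lift ord0 i | i <- enum 'I_m.+1]])%N.
  by rewrite !size_map -enumT size_enum_ord.
rewrite nth_omit // (nth_map (Ordinal ltim)) ?size_enum_ord //.
rewrite -map_comp (nth_map k) ?size_enum_ord /=; last by rewrite /bump; lia.
congr f; rewrite /lift2; congr (lift _ _); apply: val_inj => /=.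
rewrite !nth_enum_ord //; rewrite /bump; lia.
Qed.

Lemma pfbar_pfw n (A : 'M[R]_n) r : ~~ odd #|[set i : 'I_n | i.+1 \notin r]| ->
  pfbar A r = pfw A [seq i : 'I_n <- enum 'I_n | i.+1 \notin r].
Proof.
move=> keep_even; rewrite /pfbar (_ : mxsub _ _ _ = \matrix_(i, j)
   A (enum_val i) (enum_val j)); last by apply/matrixP => i j; rewrite !mxE.
rewrite (pf_pfw A) //; congr pfw.
set keep := [set i : 'I_n | _].
transitivity (enum keep).
  case: (posnP #|keep|) => [k0|k_gt0].
    have -> : enum keep = [::] by apply/size0nil; rewrite -cardE.
    by apply/size0nil; rewrite size_map size_enum_ord.
  pose x0 := enum_val (Ordinal k_gt0).
  apply: (@eq_from_nth _ x0); rewrite size_map size_enum_ord -?cardE // => i ltik.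
  by rewrite (nth_map (Ordinal ltik)) ?size_enum_ord // (enum_val_nth x0) nth_enum_ord.
rewrite /keep {1}/enum_mem -enumT; apply: eq_filter => i.
by rewrite !inE.
Qed.

End PfaffianExpansion.

(** * Nonzerodivisors modulo an ideal *)

Section NonZeroDivisor.

Variable R : comNzRingType.
Implicit Types (e : seq R) (a b c r x y z : R).

Definition nzdmod e c := forall r, r * c \in genideal e -> r \in genideal e.

Lemma genideal_nil r : (r \in genideal [::]) = (r == 0).
Proof.
apply/genidealP/eqP => [[c ->]|->]; first by rewrite big_ord0.
by exists (fun=> 0); rewrite big_ord0.
Qed.

Lemma genideal_cons a e r :
  r \in genideal (a :: e) <-> exists u, r - u * a \in genideal e.
Proof.
split=> [/genidealP[c ->]|[u /genidealP[c rE]]].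
  exists (c ord0); apply/genidealP; exists (fun i => c (lift ord0 i)).
  by rewrite big_ord_recl /= addrC addKr.
apply/genidealP; exists (fun i => if unlift ord0 i is Some j then c j else u).
rewrite big_ord_recl unlift_none /= -{1}(subrK (u * a) r) rE addrC; congr (_ + _).
by apply: eq_bigr => i _; rewrite liftK.
Qed.

Lemma genideal1P a r : r \in genideal [:: a] <-> exists u, r = u * a.
Proof.
rewrite genideal_cons; split=> [[u]|[u ->]].
  by rewrite genideal_nil subr_eq0 => /eqP ->; exists u.
by exists u; rewrite subrr rpred0.
Qed.

Lemma genideal2P a b r :
  r \in genideal [:: a; b] <-> exists u v, r = u * a + v * b.
Proof.
rewrite genideal_cons; split=> [[u]|[u [v ->]]].
  by move=> /genideal1P[v rE]; exists u, v; rewrite -rE addrC subrK.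
by exists u; apply/genideal1P; exists v; rewrite addrC addKr.
Qed.

Lemma genideal_mem a e : a \in e -> a \in genideal e.
Proof.
elim: e => // b e IHe; rewrite inE => /predU1P[->|/IHe ae]; apply/genideal_cons.
  by exists 1; rewrite mul1r subrr rpred0.
by exists 0; rewrite mul0r subr0.
Qed.

Lemma genideal2C a b r : r \in genideal [:: a; b] -> r \in genideal [:: b; a].
Proof.
by move=> /genideal2P[u [v ->]]; apply/genideal2P; exists v, u; rewrite addrC.
Qed.

Lemma nzdmod2C a b c : nzdmod [:: a; b] c -> nzdmod [:: b; a] c.
Proof. by move=> nzc r /genideal2C/nzc/genideal2C. Qed.

Lemma nzdmod1 e c : 1 \in genideal e -> nzdmod e c.
Proof. by move=> e1 r _; rewrite -[r]mulr1 genidealM. Qed.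

Lemma nzdmod_neq0 c : nzdmod [::] c -> c != 0.
Proof.
move=> nzc; apply/eqP => c0; have := nzc 1.
by rewrite c0 mulr0 rpred0 genideal_nil oner_eq0 => /(_ isT).
Qed.

Lemma nzdmod_sign e n c : nzdmod e c -> nzdmod e ((-1) ^+ n * c).
Proof.
move=> nzc r; rewrite mulrCA => ernc; apply: nzc.
by rewrite -[r * c](signrMK n) genidealM.
Qed.

Lemma nzdmod_swap23 a b c :
  nzdmod [:: a] b -> nzdmod [:: a; b] c -> nzdmod [:: a; c] b.
Proof.
move=> nzb nzc r /genideal2P[u [v rbE]].
have /nzc/genideal2P[s [t vE]] : v * c \in genideal [:: a; b].
  by apply/genideal2P; exists (- u), r; rewrite rbE mulNr addKr.
have /nzb/genideal1P[q rE] : (r - t * c) * b \in genideal [:: a].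
  by apply/genideal1P; exists (u + s * c); rewrite mulrBl rbE vE; ring.
by apply/genideal2P; exists q, t; rewrite -rE subrK.
Qed.

End NonZeroDivisor.

Lemma nzdmod_swap12 (R : idomainType) (a b : R) :
  a != 0 -> nzdmod [:: a] b -> nzdmod [:: b] a.
Proof.
move=> a0 nzb r /genideal1P[s raE].
have /nzb/genideal1P[t sE] : s * b \in genideal [:: a].
  by apply/genideal1P; exists r.
apply/genideal1P; exists t; apply: (mulIf a0).
by rewrite raE sE mulrAC.
Qed.

Lemma nzdmod_nil (R : idomainType) (a : R) : a != 0 -> nzdmod [::] a.
Proof. by move=> a0 r; rewrite !genideal_nil mulf_eq0 (negbTE a0) orbF. Qed.

(** * Elements linear in a variable *)

Lemma coefM_linear (R : comNzRingType) (p : {poly R}) (c g : R) j :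
  (p * ('X * c%:P + g%:P))`_j.+1 = p`_j * c + p`_j.+1 * g.
Proof. by rewrite mulrDr mulrA coefD !coefMC coefMX. Qed.

Section VariableFree.

Variables (A : comNzRingType) (n : nat) (k : 'I_n).
Let R := {mpoly A[n]}.

Definition isolate_var (i : 'I_n) : {poly R} :=
  if i == k then 'X else ('X_i : R)%:P.

(** The polynomial ring seen as a univariate polynomial ring in the variable
    'X_k. The coefficients are kept in the full polynomial ring, where absence of
    this variable becomes the predicate [varfree]. *)
Definition isolate : R -> {poly R} :=
  mmap (polyC \o @mpolyC n A) isolate_var.

HB.instance Definition _ := GRing.RMorphism.on isolate.

Lemma isolateB : {morph isolate : f g / f - g}. Proof. exact: rmorphB. Qed.

Lemma isolateD : {morph isolate : f g / f + g}. Proof. exact: rmorphD. Qed.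

Lemma isolateM : {morph isolate : f g / f * g}. Proof. exact: rmorphM. Qed.

Lemma isolate_sum (I : finType) (F : I -> R) :
  isolate (\sum_i F i) = \sum_i isolate (F i).
Proof. exact: raddf_sum. Qed.

Lemma isolateX i : isolate 'X_i = isolate_var i.
Proof. by rewrite /isolate mmapX mmap1U. Qed.

Lemma isolateK f : (isolate f).['X_k] = f.
Proof.
rewrite [f in RHS]mpolyE /isolate /mmap horner_sum; apply: eq_bigr => m _.
rewrite hornerM hornerC -mul_mpolyC; congr (_ * _).
rewrite /mmap1 horner_prod [RHS]mpolyXE_id; apply: eq_bigr => i _.
rewrite horner_exp /isolate_var; case: eqP => [->|_]; last by rewrite hornerC.
by rewrite hornerX.
Qed.

Definition varfree : {pred R} := fun f => isolate f == f%:P.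

Lemma varfreeP f : reflect (isolate f = f%:P) (f \in varfree).
Proof. exact: eqP. Qed.

Lemma varfree_subring : subring_closed varfree.
Proof.
split=> [|f g /varfreeP fE /varfreeP gE|f g /varfreeP fE /varfreeP gE].
- by apply/varfreeP; rewrite rmorph1.
- by apply/varfreeP; rewrite isolateB fE gE polyCB.
- by apply/varfreeP; rewrite isolateM fE gE polyCM.
Qed.

HB.instance Definition _ :=
  GRing.isSubringClosed.Build R varfree varfree_subring.

Lemma varfreeX i : i != k -> 'X_i \in varfree.
Proof. by move=> ik; apply/varfreeP; rewrite isolateX /isolate_var (negbTE ik). Qed.

(** Taking a coefficient with respect to 'X_k is linear over the polynomials
    free of it, in particular over the generators. *)
Lemma genideal_coef e f j : {subset e <= varfree} ->
  f \in genideal e -> (isolate f)`_j \in genideal e.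
Proof.
move=> e_free /genidealP[c ->]; rewrite isolate_sum coef_sum rpred_sum // => i _.
have /varfreeP eE : e`_i \in varfree by apply/e_free/mem_nth.
by rewrite isolateM eE coefMC genidealM ?genideal_mem ?mem_nth.
Qed.

(** The leading coefficient of r * ('X_k * c + g) is that of r times c, so it
    belongs to the ideal only if that of r does; the other coefficients follow
    by descending induction. *)
Lemma nzdmod_linear e c g :
    {subset e <= varfree} -> c \in varfree -> g \in varfree ->
  nzdmod e c -> nzdmod e ('X_k * c + g).
Proof.
move=> e_free /varfreeP cE /varfreeP gE nzc r er.
have coef_r j : (isolate r)`_j \in genideal e.
  have [d] := ubnP (size (isolate r) - j); elim: d j => // d IHd j ltd.
  have [lerj|ltjr] := leqP (size (isolate r)) j.
    by rewrite nth_default // rpred0.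
  have rj1 : (isolate r)`_j.+1 \in genideal e by apply: IHd; lia.
  apply: nzc; have := genideal_coef j.+1 e_free er.
  rewrite isolateM isolateD isolateM isolateX /isolate_var eqxx cE gE.
  rewrite coefM_linear => er1.
  by rewrite -[_ * c](addrK ((isolate r)`_j.+1 * g)) rpredB // mulrC genidealM.
rewrite -[r]isolateK horner_coef rpred_sum // => j _.
by rewrite mulrC genidealM.
Qed.

End VariableFree.

(** * Regular sequences of Pfaffians *)

Lemma rpred_pfw (R : comNzRingType) (I : eqType) (T : I -> I -> R)
    (S : subringClosed R) (w : seq I) :
  {in w &, forall i j, T i j \in S} -> pfw T w \in S.
Proof.
have [m] := ubnP (size w); elim: m w => // m IHm [|a w] /=.
  by move=> _ _; rewrite pfw_nil rpred1.
rewrite ltnS => ltwm TS; rewrite (pfw_cons _ a) rpred_sum // => k _.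
rewrite rpredMsign rpredM ?TS ?mem_head ?inE ?mem_nth ?orbT //.
apply: IHm => [|i j /omit_subset iw /omit_subset jw].
  by rewrite size_omit // (leq_ltn_trans (leq_pred _)).
by rewrite TS // inE (iw, jw) orbT.
Qed.

(** The only property of the generic matrix that the induction on words needs:
    pf(b w) is a nonzerodivisor modulo Pfaffians of words that do not contain
    both b and w_i, as soon as the Pfaffian of w without w_i is. *)
Definition new_letter_regular (R : comNzRingType) n (T : 'I_n -> 'I_n -> R) :=
  forall (us : seq (seq 'I_n)) (b : 'I_n) (w : seq 'I_n) i,
    (i < size w)%N -> (b < nth b w i)%N -> uniq (b :: w) ->
    (forall u, u \in us -> b \notin u \/ nth b w i \notin u) ->
  nzdmod [seq pfw T u | u <- us] (pfw T (omit i w)) ->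
  nzdmod [seq pfw T u | u <- us] (pfw T (b :: w)).

Section GenericSkew.

Variable n : nat.
Let T : 'I_n -> 'I_n -> tauring n := genskew n.
Implicit Types (a b : 'I_n) (w : seq 'I_n).

Lemma genskew_skew (i j : 'I_n) : T j i = - T i j.
Proof. by rewrite /T !mxE opprB. Qed.

Lemma genskew_diag (i : 'I_n) : T i i = 0.
Proof. by rewrite /T mxE subrr. Qed.

Lemma tau_ge (i j : 'I_n) : (j <= i)%N -> tau i j = 0.
Proof. by move=> leji; rewrite /tau insubN //= -leqNgt. Qed.

Lemma genskew_lt (i j : 'I_n) (ltij : (i < j)%N) :
  T i j = 'X_(enum_rank (exist _ (i, j) ltij : upair n)).
Proof.
rewrite /T mxE [tau j i]tau_ge 1?ltnW // subr0 /tau insubT /=.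
by congr ('X_(enum_rank _)); apply: val_inj.
Qed.

Lemma genskew_varfree (p : upair n) (i j : 'I_n) :
  (val p).1 \notin [:: i; j] \/ (val p).2 \notin [:: i; j] ->
  T i j \in varfree (enum_rank p).
Proof.
have tau_free k l : ((val p).1 != k) || ((val p).2 != l) ->
    tau k l \in varfree (enum_rank p).
  rewrite -negb_and => pkl; rewrite /tau; case: insubP => [q _ qE|_]; last exact: rpred0.
  apply: varfreeX; rewrite (inj_eq enum_rank_inj); apply: contraNneq pkl => <-.
  by rewrite qE !eqxx.
rewrite /T mxE => ppij; rewrite rpredB // tau_free //; move: ppij;
  by rewrite !inE !negb_or => -[] /andP[pi pj]; rewrite ?pi ?pj ?orbT.
Qed.

Lemma pfw_varfree (p : upair n) w :
  (val p).1 \notin w \/ (val p).2 \notin w -> pfw T w \in varfree (enum_rank p).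
Proof.
move=> pw; apply: rpred_pfw => i j iw jw; apply: genskew_varfree.
by case: pw => pw; [left | right]; apply: contra pw; rewrite !inE => /orP[] /eqP ->.
Qed.

(** The variable at position (b, w_i) occurs in a Pfaffian only if both letters
    do, and its coefficient in pf(b w) is the Pfaffian of w without w_i up to
    sign. *)
Lemma genskew_new_letter : new_letter_regular T.
Proof.
move=> us b w i ltiw ltbw /andP[bw uw] us_free nzi.
pose p : upair n := exist _ (b, nth b w i) ltbw.
have free u : b \notin u \/ nth b w i \notin u -> pfw T u \in varfree (enum_rank p).
  by move=> bu; apply: pfw_varfree.
have b_omit k : b \notin omit k w by apply: contra bw; apply: omit_subset.
rewrite (pfw_cons_split T b b ltiw) (genskew_lt ltbw) -/p.
apply: nzdmod_linear.
- by move=> _ /mapP[u /us_free + ->]; apply: free.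
- by rewrite rpredMsign free //; left.
- rewrite rpred_sum // => k ki; rewrite rpredMsign rpredM ?free //; last by left.
  apply: genskew_varfree; right; rewrite /= !inE negb_or nth_uniq //.
  rewrite [X in _ && ~~ X]eq_sym ki andbT.
  by apply: contraNneq bw => <-; rewrite mem_nth.
- exact: nzdmod_sign.
Qed.

End GenericSkew.

Section RegularPfaffians.

Variables (R : idomainType) (n : nat) (T : 'I_n -> 'I_n -> R).
Implicit Types (a b c : 'I_n) (w : seq 'I_n).

Hypothesis nzdmod_pfw_cons : new_letter_regular T.

Lemma pfw_neq0_cons b w i :
    (i < size w)%N -> (b < nth b w i)%N -> uniq (b :: w) ->
  pfw T (omit i w) != 0 -> pfw T (b :: w) != 0.
Proof.
move=> ltiw ltbw ubw nz; apply: nzdmod_neq0.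
by apply: (@nzdmod_pfw_cons [::]) ltbw ubw _ _ => //; apply: nzdmod_nil.
Qed.

Definition increasing : pred (seq 'I_n) := sorted (fun i j : 'I_n => i < j)%N.

Lemma increasing_cons b w : increasing (b :: w) ->
  [/\ increasing w, uniq (b :: w) & forall c, c \in w -> (b < c)%N].
Proof.
move=> bw_inc; split; first exact: path_sorted bw_inc.
  apply: sorted_uniq bw_inc => [c a d|c]; [exact: ltn_trans | exact: ltnn].
by apply/allP; apply: order_path_min bw_inc => c a d; apply: ltn_trans.
Qed.

Lemma increasing_del1 a b w : increasing (a :: b :: w) -> increasing (a :: w).
Proof.
case: w => // c w /= /and3P[ltab ltbc ->].
by rewrite (ltn_trans ltab ltbc).
Qed.

(** The three Pfaffians of the conclusion are those of the words obtained from
    a b w by removing a, b, and the first letter of w. The last one is linear in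
    the variable at (a, b), with coefficient the Pfaffian of w without its first
    letter. *)
Lemma regular_extend a b w : increasing (a :: b :: w) ->
    odd (size w) -> pfw T (omit 0 w) != 0 ->
    (forall c, increasing (c :: w) -> nzdmod [:: pfw T (omit 0 w)] (pfw T (c :: w))) ->
    nzdmod [:: pfw T (omit 0 w); pfw T (b :: w)] (pfw T (a :: w)) ->
  [/\ pfw T (b :: w) != 0, nzdmod [:: pfw T (b :: w)] (pfw T (a :: w)) &
      nzdmod [:: pfw T (b :: w); pfw T (a :: w)] (pfw T (a :: b :: omit 0 w))].
Proof.
case: w => // w0 w; rewrite omit0; set P0 := pfw T w.
move=> abw_inc _ P0_nz nzx nzy; have aw_inc := increasing_del1 abw_inc.
have [bw_inc abw_uniq lta] := increasing_cons abw_inc.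
have [_ bw_uniq ltb] := increasing_cons bw_inc.
have [_ aw_uniq _] := increasing_cons aw_inc.
have aE : a != b by move: abw_uniq; rewrite /= inE negb_or => /andP[/andP[]].
have a_bw : a \notin b :: w0 :: w by move: abw_uniq => /= /andP[].
have b_w : b \notin w0 :: w by move: bw_uniq => /= /andP[].
have w0_w : w0 \notin w by move: bw_uniq => /= /and3P[].
have x_nz : pfw T (b :: w0 :: w) != 0.
  by apply: (@pfw_neq0_cons _ _ 0) => //; [rewrite ltb ?mem_head | rewrite omit0].
have nzP0 := nzdmod_swap12 P0_nz (nzx _ bw_inc).
have nzyx : nzdmod [:: pfw T (b :: w0 :: w)] (pfw T (a :: w0 :: w)).
  apply: (@nzdmod_pfw_cons [:: b :: w0 :: w] _ _ 0) => //.
  - by rewrite lta //= !inE eqxx orbT.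
  - by move=> u; rewrite inE => /eqP ->; left.
  - by rewrite /= omit0.
split=> //.
apply: (@nzdmod_pfw_cons [:: b :: w0 :: w; a :: w0 :: w] _ _ 0) => //.
- by rewrite lta ?mem_head.
- move: abw_uniq; rewrite /= !inE !negb_or -!andbA.
  by move=> /and5P[-> _ -> _] /and3P[-> _ ->].
- move=> u; rewrite !inE => /orP[] /eqP -> /=; first by left.
  by right; rewrite inE negb_or b_w eq_sym aE.
- rewrite /= omit0; apply: nzdmod_swap23 => //; exact: nzdmod2C.
Qed.

(** The words b w and a w are what remains of a b w when a or b is removed. With
    w starting at the third index this is the regular sequence u, p1, p2. *)
Lemma regular_pfw w : increasing w -> odd (size w) ->
  [/\ pfw T (omit 0 w) != 0,
      forall b, increasing (b :: w) ->
        nzdmod [:: pfw T (omit 0 w)] (pfw T (b :: w)) &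
      forall a b, increasing (a :: b :: w) ->
        nzdmod [:: pfw T (omit 0 w); pfw T (b :: w)] (pfw T (a :: w))].
Proof.
have [m] := ubnP (size w); elim: m w => // m IHm [|a' [|b' w]] //.
  move=> _ _ _; rewrite omit0 pfw_nil oner_eq0.
  (* For a single letter the first Pfaffian is that of the empty word, a unit. *)
  by split=> // [b _|a b _]; apply: nzdmod1; apply: genideal_mem; rewrite mem_head.
rewrite ltnS => ltwm abw_inc; rewrite [odd _]/= negbK => w_odd.
have [bw_inc abw_uniq lta'] := increasing_cons abw_inc.
have [w_inc _ _] := increasing_cons bw_inc.
have [|P0_nz nzx nzy] := IHm w _ w_inc w_odd; first by rewrite (leq_trans _ ltwm) //= ltnW.
have [Q0_nz nz1 nz2] := regular_extend abw_inc w_odd P0_nz nzx (nzy _ _ abw_inc).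
case: w => // w0 w in w_odd ltwm abw_inc bw_inc abw_uniq lta' w_inc P0_nz nzx nzy Q0_nz nz1 nz2 *.
rewrite !omit0 in Q0_nz nz1 nz2 *; set W := [:: a', b', w0 & w].
have W1 : omit 1 W = a' :: w0 :: w by rewrite omitS omit0.
have W2 : omit 2 W = a' :: b' :: w by rewrite !omitS omit0.
have nzb b : increasing (b :: W) ->
    nzdmod [:: pfw T (b' :: w0 :: w)] (pfw T (b :: W)).
  case/increasing_cons=> _ b_uniq ltb.
  apply: (@nzdmod_pfw_cons [:: b' :: w0 :: w] _ _ 1) => //.
  - by rewrite ltb // mem_nth.
  - move=> u; rewrite inE => /eqP ->; left.
    by move: b_uniq => /= /andP[]; rewrite inE negb_or => /andP[].
split=> // a b abW_inc; have [bW_inc abW_uniq ltaW] := increasing_cons abW_inc.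
have [_ bW_uniq ltbW] := increasing_cons bW_inc.
have bW : b \notin W by case/andP: bW_uniq.
have a_bW : a \notin b :: W by case/andP: abW_uniq.
have aW_uniq : uniq (a :: W).
  by case/andP: bW_uniq => _; rewrite /= => ->; move: a_bW; rewrite inE negb_or => /andP[_ ->].
apply: (@nzdmod_pfw_cons [:: b' :: w0 :: w; b :: W] _ _ 1) => //.
- by rewrite ltaW // inE mem_nth ?orbT.
- move=> u; rewrite !inE => /orP[] /eqP ->; left => //.
  by apply: contra a_bW => aw; rewrite !inE in aw *; rewrite aw !orbT.
- rewrite W1; apply: nzdmod_swap23 => //.
  apply: (@nzdmod_pfw_cons [:: b' :: w0 :: w; a' :: w0 :: w] _ _ 2) => //.
  + by rewrite ltbW // mem_nth.
  + move=> u; rewrite !inE => /orP[] /eqP ->; left;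
      apply: contra bW => bw; rewrite !inE in bw *.
      by rewrite bw !orbT.
    by case/orP: bw => ->; rewrite ?orbT.
  + by rewrite W2.
Qed.

End RegularPfaffians.

(** * Acyclicity from annihilators of the homology *)

Lemma cV_scalerI (R : idomainType) m (a : R) (y z : 'cV[R]_m) :
  a != 0 -> a *: y = a *: z -> y = z.
Proof.
move=> a0 /matrixP yz; apply/matrixP => i j; apply: (mulfI a0).
by have := yz i j; rewrite !mxE.
Qed.

Section Acyclicity.

Variables (R : idomainType) (b3 b2 b1 b0 : nat).
Variables (D3 : 'M[R]_(b2, b3)) (D2 : 'M[R]_(b1, b2)) (D1 : 'M[R]_(b0, b1)).
Variables (a1 a2 a3 : R).
Hypotheses (a1_neq0 : a1 != 0) (a2_nzd : nzdmod [:: a1] a2)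
  (a3_nzd : nzdmod [:: a1; a2] a3).

Lemma nzdmod1_cV m (y z : 'cV[R]_m) :
  a2 *: y = a1 *: z -> exists w, y = a1 *: w.
Proof.
move=> yz.
have /choice[w wP] : forall i, exists u, y i 0 = u * a1.
  move=> i; apply/genideal1P/a2_nzd/genideal1P; exists (z i 0).
  by have /matrixP/(_ i 0) := yz; rewrite !mxE mulrC => ->; rewrite mulrC.
exists (\col_i w i); apply/matrixP => i j.
by rewrite ord1 !mxE mulrC -wP.
Qed.

Lemma nzdmod2_cV m (x y z : 'cV[R]_m) :
  a3 *: x = a1 *: y + a2 *: z -> exists s t, x = a1 *: s + a2 *: t.
Proof.
move=> xyz.
have /choice[w wP] : forall i, exists u : R * R, x i 0 = u.1 * a1 + u.2 * a2.
  move=> i; have /a3_nzd/genideal2P[u [v ->]] : x i 0 * a3 \in genideal [:: a1; a2].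
    apply/genideal2P; exists (y i 0), (z i 0).
    have /matrixP/(_ i 0) := xyz; rewrite !mxE mulrC => ->.
    by rewrite (mulrC a1) (mulrC a2).
  by exists (u, v).
exists (\col_i (w i).1), (\col_i (w i).2); apply/matrixP => i j.
by rewrite ord1 !mxE wP (mulrC a1) (mulrC a2).
Qed.

Hypotheses (D3_inj : injective (mulmx D3 : 'cV_b3 -> 'cV_b2)) (D23 : D2 *m D3 = 0)
  (D12 : D1 *m D2 = 0).

Hypothesis kill2 : forall a, a \in [:: a1; a2] -> forall y : 'cV_b2,
  D2 *m y = 0 -> exists z, D3 *m z = a *: y.

(** If a1 y = D3 z1 and a2 y = D3 z2, then a2 z1 = a1 z2 as D3 is injective, so
    z1 is a multiple of a1. *)
Lemma acyclic2 : exact_at (mulmx D3 : 'cV_b3 -> 'cV_b2) (mulmx D2).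
Proof.
move=> y; split=> [y0|[z <-]]; last by rewrite mulmxA D23 mul0mx.
have [z1 z1E] := kill2 (mem_head _ _) y0.
have [|z2 z2E] := kill2 (a := a2) _ y0; first by rewrite !inE eqxx orbT.
have [|w wE] := @nzdmod1_cV _ z1 z2.
  by apply: D3_inj; rewrite -!scalemxAr z1E z2E !scalerA mulrC.
exists w; apply: (cV_scalerI a1_neq0).
by rewrite -z1E wE scalemxAr.
Qed.

Hypothesis kill1 : forall a, a \in [:: a1; a2; a3] -> forall y : 'cV_b1,
  D1 *m y = 0 -> exists z, D2 *m z = a *: y.

(** Preimages z_i of the a_i y differ by boundaries: a_i z_j - a_j z_i = D3 w_ij.
    The w_ij satisfy the Koszul relation, so w_12 is a combination of a1 and a2
    with vector coefficients, and correcting z_1 and z_2 by boundaries makes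
    them proportional to a1 and a2. *)
Lemma acyclic1 : exact_at (mulmx D2 : 'cV_b2 -> 'cV_b1) (mulmx D1).
Proof.
move=> y; split=> [y0|[z <-]]; last by rewrite mulmxA D12 mul0mx.
have [z1 z1E] := kill1 (mem_head _ _) y0.
have [|z2 z2E] := kill1 (a := a2) _ y0; first by rewrite !inE eqxx orbT.
have [|z3 z3E] := kill1 (a := a3) _ y0; first by rewrite !inE eqxx !orbT.
have syzygy a b z z' : D2 *m z = a *: y -> D2 *m z' = b *: y ->
    exists w, D3 *m w = a *: z' - b *: z.
  move=> zE z'E; apply/acyclic2.
  by rewrite mulmxBr -!scalemxAr zE z'E !scalerA mulrC subrr.
have [w12 w12E] := syzygy _ _ _ _ z1E z2E.
have [w13 w13E] := syzygy _ _ _ _ z1E z3E.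
have [w23 w23E] := syzygy _ _ _ _ z2E z3E.
have [|s [t w12st]] := @nzdmod2_cV _ w12 (- w23) w13.
  apply: D3_inj; rewrite mulmxDr -!scalemxAr mulmxN w12E w13E w23E.
  by apply/matrixP => i j; rewrite !mxE; ring.
have [|q qE] := @nzdmod1_cV _ (z1 + D3 *m t) (z2 - D3 *m s).
  move: w12E; rewrite w12st mulmxDr -!scalemxAr => w12E.
  apply/eqP; rewrite scalerDr scalerBr eq_sym subr_eq -addrA.
  by rewrite [X in _ == _ + X]addrC w12E addrC subrK.
exists q; apply: (cV_scalerI a1_neq0).
by rewrite scalemxAr -qE mulmxDr mulmxA D23 mul0mx addr0.
Qed.

End Acyclicity.

(** * The complex of a skew matrix of odd size *)

Lemma filter_neq_nth (I : eqType) (x0 : I) w k : uniq w -> (k < size w)%N ->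
  [seq a <- w | a != nth x0 w k] = omit k w.
Proof.
elim: w k => [|b w IHw] [|k] //= /andP[bw uw] ltkw.
  rewrite eqxx omit0; apply/all_filterP/allP => a aw.
  by apply: contraNneq bw => <-.
rewrite omitS IHw // ifT //; apply: contraNneq bw => ->; exact: mem_nth.
Qed.

Section Complex.

Variables (R : idomainType) (n : nat) (T : 'M[R]_n).
Hypotheses (n_gt2 : (2 < n)%N) (n_odd : odd n).
Hypotheses (T_skew : forall i j, T j i = - T i j) (T_diag : forall i, T i i = 0).

Let i1 : 'I_n := Ordinal (ltn_trans (isT : 0 < 2)%N n_gt2).
Let i2 : 'I_n := Ordinal (ltn_trans (isT : 1 < 2)%N n_gt2).
Let i3 : 'I_n := Ordinal n_gt2.
Let V := enum 'I_n.
Let W := [seq shift3 j | j <- enum 'I_(n - 3)].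
Local Notation pf := (pfw T).

Let u := pf W.
Let p1 := pf [:: i2, i3 & W].
Let p2 := pf [:: i1, i3 & W].
Let p3 := pf [:: i1, i2 & W].

Lemma sizeW : size W = (n - 3)%N.
Proof. by rewrite size_map size_enum_ord. Qed.

Lemma nthW k (ltk : (k < n - 3)%N) : nth i1 W k = shift3 (Ordinal ltk).
Proof.
rewrite (nth_map (Ordinal ltk)) ?size_enum_ord //; congr shift3.
by apply: val_inj; rewrite /= nth_enum_ord.
Qed.

Lemma val_nthW k : (k < n - 3)%N -> nth i1 W k = (3 + k)%N :> nat.
Proof. by move=> ltk; rewrite (nthW ltk). Qed.

(** The word of all indices. In it i1, i2, i3 have the values 0, 1, 2, so they
    are the indices called 1, 2, 3 in [pfbar]. *)
Lemma enumV : V = [:: i1, i2, i3 & W].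
Proof.
apply: (@eq_from_nth _ i1); first by rewrite /= sizeW size_enum_ord; lia.
rewrite size_enum_ord => k ltkn; apply: val_inj; rewrite /V /= nth_enum_ord //.
case: k ltkn => [|[|[|k]]] //= ltkn; rewrite val_nthW //; lia.
Qed.

Lemma mem_W i : (i \in W) = (2 < i)%N.
Proof.
apply/mapP/idP => [[j _ ->] //|lti].
have ltj : (i - 3 < n - 3)%N by have := ltn_ord i; lia.
exists (Ordinal ltj); first by rewrite mem_enum.
by apply: val_inj; rewrite /= subnKC.
Qed.

Lemma uniqW : uniq W.
Proof.
have := enum_uniq 'I_n; rewrite -/V enumV -(cat1s i1) -(cat1s i2) -(cat1s i3).
by rewrite !cat_uniq => /and3P[_ _ /and3P[_ _ /and3P[]]].
Qed.

Lemma sumV (S : nmodType) (F : 'I_n -> S) :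
  \sum_i F i = F i1 + (F i2 + (F i3 + \sum_(k < n - 3) F (nth i1 W k))).
Proof.
rewrite -big_enum -/V enumV !big_cons; congr (_ + (_ + (_ + _))).
by rewrite (big_nth i1) sizeW big_mkord.
Qed.

Lemma pfbarE r w : ~~ odd (size w) ->
  [seq i : 'I_n <- V | i.+1 \notin r] = w -> pfbar T r = pf w.
Proof.
move=> w_even wE; rewrite pfbar_pfw; first by rewrite wE.
rewrite cardE [enum _](_ : _ = w) // -wE /V {1}/enum_mem -enumT.
by apply: eq_filter => i; rewrite !inE.
Qed.

Lemma pfbar123 : pfbar T [:: 1; 2; 3] = u.
Proof.
apply: pfbarE; first by rewrite sizeW; lia.
rewrite enumV /=; apply/all_filterP/allP => i; rewrite mem_W !inE; lia.
Qed.

Lemma pfbar_one (j : 'I_n) : pfbar T [:: j.+1] = pf (omit j V).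
Proof.
apply: pfbarE; first by rewrite size_omit size_enum_ord //; lia.
rewrite -(filter_neq_nth i1) ?enum_uniq ?size_enum_ord // nth_ord_enum.
by apply: eq_filter => i; rewrite inE.
Qed.

Lemma pfbar_two (r : 'I_n) k : (r < 3)%N -> (k < n - 3)%N ->
  pfbar T (rcons (rem r.+1 [:: 1; 2; 3]) (3 + k).+1) = pf (r :: omit k W).
Proof.
move=> ltr ltk; apply: pfbarE; first by rewrite /= size_omit sizeW; lia.
have -> : omit k W = [seq i : 'I_n <- W | i.+1 \notin [:: 1; 2; 3; (3 + k).+1]%N].
  rewrite -(filter_neq_nth i1) ?uniqW ?sizeW //; apply: eq_in_filter => i.
  rewrite mem_W -(inj_eq val_inj) /= val_nthW // !inE; lia.
rewrite enumV; case: r ltr => -[|[|[|//]]] /= ltr _;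
  (congr (_ :: _); [exact: val_inj | apply: eq_in_filter => i]);
  rewrite mem_W !inE; lia.
Qed.

Lemma pfbar1 : pfbar T [:: 1%N] = p1.
Proof. by rewrite (pfbar_one i1) enumV omit0. Qed.

Lemma pfbar2 : pfbar T [:: 2%N] = p2.
Proof. by rewrite (pfbar_one i2) enumV omitS omit0. Qed.

Lemma pfbar3 : pfbar T [:: 3%N] = p3.
Proof. by rewrite (pfbar_one i3) enumV !omitS omit0. Qed.

Lemma del2_low (r : 'I_4) (i j : 'I_n) : r = i :> nat -> (i < 3)%N -> (j < 3)%N ->
  del2 T r j = if i == j then u else 0.
Proof.
move=> ri lti ltj; rewrite mxE ri ltj pfbar123 eqSS ltn_eqF //.
Qed.

Lemma del2_high (r : 'I_4) (i : 'I_n) k :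
    r = i :> nat -> (i < 3)%N -> (k < n - 3)%N ->
  del2 T r (nth i1 W k) = (-1) ^+ k.+1 * pf (i :: omit k W).
Proof.
move=> ri lti ltk; rewrite mxE ri val_nthW // eqSS ltn_eqF //= pfbar_two //.
by rewrite addSn !exprS; ring.
Qed.

Lemma del2_last (j : 'I_n) : del2 T ord_max j = (-1) ^+ j * pf (omit j V).
Proof. by rewrite mxE /= pfbar_one. Qed.

Lemma del2_row (r : 'I_4) (i : 'I_n) (y : 'cV_n) : r = i :> nat -> (i < 3)%N ->
  (del2 T *m y) r 0 = u * y i 0 +
    \sum_(k < n - 3) (-1) ^+ k.+1 * pf (i :: omit k W) * y (nth i1 W k) 0.
Proof.
move=> ri lti; rewrite mxE sumV !(del2_low ri) // !addrA; congr (_ + _); last first.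
  by apply: eq_bigr => k _; rewrite (del2_high ri).
rewrite -!(inj_eq val_inj) /=.
case: i lti {ri} => -[|[|[|//]]] /= lti _; rewrite ?mul0r ?add0r ?addr0;
  by congr (_ * y _ 0); apply: val_inj.
Qed.

Lemma del2_row_last (y : 'cV_n) :
  (del2 T *m y) ord_max 0 = \sum_(j < n) (-1) ^+ j * pf (omit j V) * y j 0.
Proof. by rewrite mxE; apply: eq_bigr => j _; rewrite del2_last. Qed.

Lemma del2T_col (r : 'I_4) k : (del2 T *m T) r k = (del2 T *m col k T) r 0.
Proof. by rewrite !mxE; apply: eq_bigr => j _; rewrite [col k T j 0]mxE. Qed.

Lemma pf_rep a w : a \in w -> pf (a :: w) = 0.
Proof. exact: pfw_rep. Qed.

(** This is the expansion of the Pfaffian of a word containing k twice. *)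
Lemma del2T_last k : (del2 T *m T) ord_max k = 0.
Proof.
rewrite del2T_col del2_row_last.
transitivity (- pf (k :: V)); last by rewrite pf_rep ?oppr0 ?mem_enum.
rewrite (pfw_cons _ i1) size_enum_ord -sumrN; apply: eq_bigr => j _.
by rewrite nth_ord_enum mxE T_skew; ring.
Qed.

Lemma del2T_row (r : 'I_4) (i : 'I_n) k : r = i :> nat -> (i < 3)%N ->
  (del2 T *m T) r k = - pf [:: k, i & W].
Proof.
move=> ri lti; rewrite del2T_col (del2_row _ ri lti) (pfw_cons2 _ i1) sizeW.
rewrite mxE (T_skew k i) opprB addrC; congr (_ + _); last by rewrite mulrN mulrC.
by apply: eq_bigr => l _; rewrite mxE T_skew exprS; ring.
Qed.

Lemma del2T_W (r : 'I_4) (k : 'I_n) : (2 < k)%N -> (del2 T *m T) r k = 0.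
Proof.
move=> ltk; have [->|r_max] := eqVneq r ord_max; first exact: del2T_last.
have ltr : (r < 3)%N.
  by move: r_max; rewrite -(inj_eq val_inj) /= ltn_neqAle -ltnS ltn_ord andbT.
have ltrn : (r < n)%N by apply: leq_trans ltr _.
by rewrite (@del2T_row _ (Ordinal ltrn)) // pf_rep ?oppr0 // inE mem_W ltk orbT.
Qed.

Definition extend3 (z : 'cV[R]_(n - 3)) : 'cV[R]_n :=
  \col_i if insub (i - 3)%N is Some j then if (2 < i)%N then z j 0 else 0 else 0.

Definition restrict3 (z : 'cV[R]_n) : 'cV[R]_(n - 3) := \col_j z (shift3 j) 0.

Lemma extend3_low z (i : 'I_n) : (i <= 2)%N -> extend3 z i 0 = 0.
Proof. by rewrite mxE leqNgt => /negbTE ->; case: insub. Qed.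

Lemma extend3_shift z (j : 'I_(n - 3)) : extend3 z (shift3 j) 0 = z j 0.
Proof.
rewrite mxE /= addKn insubT // => ltj.
by congr (z _ 0); apply: val_inj.
Qed.

Lemma shift3K (i : 'I_n) : (2 < i)%N -> exists j, i = shift3 j.
Proof. by rewrite -mem_W => /mapP[j _ ->]; exists j. Qed.

Lemma restrict3K (z : 'cV[R]_n) :
  (forall i : 'I_n, (i <= 2)%N -> z i 0 = 0) -> extend3 (restrict3 z) = z.
Proof.
move=> z0; apply/matrixP => i j; rewrite ord1.
have [lei|/shift3K[k ->]] := leqP i 2; first by rewrite extend3_low ?z0.
by rewrite extend3_shift mxE.
Qed.

Lemma del3E z : del3 T *m z = T *m extend3 z.
Proof.
apply/matrixP => i j; rewrite ord1 !mxE sumV !extend3_low // !mulr0 !add0r.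
apply: eq_bigr => k _; rewrite (nthW (ltn_ord k)) extend3_shift mxE.
by congr (T _ (shift3 _) * z _ _); apply: val_inj.
Qed.

Lemma del2_del3 : del2 T *m del3 T = 0.
Proof.
apply/matrixP => r j; rewrite mxE.
transitivity ((del2 T *m T) r (shift3 j)).
  by rewrite mxE; apply: eq_bigr => i _; rewrite [del3 T i j]mxE.
by rewrite del2T_W // mxE.
Qed.

Lemma del1_mul (y : 'cV_4) : (del1 T *m y) 0 0 =
  - p1 * y 0 0 + p2 * y 1 0 - p3 * y (inord 2) 0 + u * y ord_max 0.
Proof.
rewrite mxE !big_ord_recl big_ord0 !mxE /= pfbar1 pfbar2 pfbar3 pfbar123 addr0.
rewrite -mulNr !addrA; congr (_ + _ + _ + _);
  by congr (_ * y _ 0); apply: val_inj; rewrite /= ?inordK.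
Qed.

(** The exchange relation for the word of all indices and the odd word W with
    its k-th letter removed; only the letters of the first word that are absent
    from the second one contribute. *)
Lemma pf_exchange k : (k < n - 3)%N ->
  u * pf [:: i1, i2, i3 & omit k W] =
  p1 * pf (i1 :: omit k W) - p2 * pf (i2 :: omit k W) + p3 * pf (i3 :: omit k W).
Proof.
move=> ltk; have := pfw_exchange T_skew i1 (omit k W) [:: i1, i2, i3 & W].
rewrite big1 => [|i _]; last first.
  rewrite pf_rep ?mulr0 // !inE (@omit_subset _ k W) ?orbT //.
  by apply: mem_nth; rewrite ltn_ord.
rewrite add0r /= !big_ord_recl /= /bump /= !add1n !omitS !omit0.
rewrite sizeW (bigD1 (Ordinal ltk)) //= big1 => [|l lk]; last first.
  rewrite /bump /= !add1n /= [pf (nth i1 W l :: _)]pf_rep ?mulr0 //.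
  rewrite mem_omit ?uniqW ?sizeW // mem_nth ?sizeW // andbT.
  by rewrite (set_nth_default i1) ?sizeW // nth_uniq ?uniqW ?sizeW.
rewrite /bump /= !add1n !omitS /= (pfw_insert T_skew) ?sizeW // addr0.
rewrite !exprS expr0 -/u -/p1 -/p2 -/p3; set s := (-1) ^+ k.
have ss : s * s = 1 by rewrite -expr2 sqrr_sign.
move=> E; apply/eqP; rewrite -subr_eq0; apply/eqP.
transitivity (- (1 * (p1 * pf (i1 :: omit k W)) + (-1 * 1 * (p2 * pf (i2 :: omit k W)) +
  (-1 * (-1 * 1) * (p3 * pf (i3 :: omit k W)) + -1 * (-1 * (-1 * s)) *
   (pf [:: i1, i2, i3 & omit k W] * (s * u)))))).
  by ring: ss.
by rewrite E oppr0.
Qed.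

Lemma ord_low (j : 'I_n) : (j <= 2)%N -> [\/ j = i1, j = i2 | j = i3].
Proof.
by case: j => -[|[|[|//]]] ltj _; [apply: Or31 | apply: Or32 | apply: Or33];
  apply: val_inj.
Qed.

Lemma ord_high (j : 'I_n) : (2 < j)%N ->
  exists2 k, (k < n - 3)%N & j = nth i1 W k.
Proof.
move=> ltj; exists (j - 3)%N; first by have := ltn_ord j; lia.
apply: val_inj; rewrite /= val_nthW ?subnKC //; have := ltn_ord j; lia.
Qed.

Lemma del2_last_low : [/\ del2 T ord_max i1 = p1, del2 T ord_max i2 = - p2 &
  del2 T ord_max i3 = p3].
Proof.
split; rewrite del2_last enumV.
- by rewrite omit0 mul1r.
- by rewrite omitS omit0 mulN1r.
- by rewrite !omitS omit0 /= sqrrN expr1n mul1r.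
Qed.

Lemma del1_del2 : del1 T *m del2 T = 0.
Proof.
have [l1 l2 l3] := del2_last_low.
have E2 : (inord 2 : 'I_4) = 2%N :> nat by rewrite inordK.
apply/matrixP => r j; rewrite ord1 [RHS]mxE.
transitivity ((del1 T *m col j (del2 T)) 0 0).
  by rewrite [LHS]mxE [RHS]mxE; apply: eq_bigr => i _; rewrite [col _ _ _ _]mxE.
rewrite del1_mul ![col _ _ _ _]mxE.
have [/ord_low|/ord_high[k ltk ->]] := leqP j 2.
  move=> ji; have ltj : (j < 3)%N by case: ji => ->.
  rewrite (@del2_low 0 i1) // (@del2_low 1 i2) // (@del2_low _ i3 _ E2) //.
  by case: ji => ->; rewrite /= ?l1 ?l2 ?l3; ring.
rewrite (@del2_high 0 i1) // (@del2_high 1 i2) // (@del2_high _ i3 _ E2) //.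
rewrite del2_last enumV val_nthW // addSn omitS addSn omitS addSn omitS add0n.
have := pf_exchange ltk; rewrite !exprS => E.
transitivity ((-1) ^+ k * (p1 * pf (i1 :: omit k W) - p2 * pf (i2 :: omit k W) +
  p3 * pf (i3 :: omit k W) - u * pf [:: i1, i2, i3 & omit k W])); first by ring.
by rewrite E subrr mulr0.
Qed.

(** The Pfaffian adjugate of the submatrix of T on the letters of E, applied to
    y and extended by zero. The entries of the adjugate are the signed
    Pfaffians of E with two letters removed. *)
Definition word_adj (E : seq 'I_n) (y : 'cV[R]_n) : 'cV[R]_n :=
  \sum_(i < size E) \sum_(l < (size E).-1)
    ((-1) ^+ (i + l) * y (nth i1 E i) 0 * pf (omit l (omit i E))) *:
      delta_mx (nth i1 (omit i E) l) 0.

Lemma mulT_word_adj E y k : (T *m word_adj E y) k 0 =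
  \sum_(i < size E) (-1) ^+ i * (y (nth i1 E i) 0 * pf (k :: omit i E)).
Proof.
rewrite /word_adj mulmx_sumr summxE; apply: eq_bigr => i _.
rewrite mulmx_sumr summxE (pfw_cons _ i1) size_omit // !mulr_sumr.
apply: eq_bigr => l _; rewrite -scalemxAr -colE mxE [col _ _ _ _]mxE exprD.
by ring.
Qed.

Lemma mulT_word_adj_in E y k : uniq E -> k \in E ->
  (T *m word_adj E y) k 0 = pf E * y k 0.
Proof.
move=> uE kE; have ltk : (index k E < size E)%N by rewrite index_mem.
rewrite mulT_word_adj (bigD1 (Ordinal ltk)) //= big1 => [|i ik]; last first.
  rewrite pf_rep ?mulr0 // mem_omit // kE andbT.
  by rewrite -[X in X != _](nth_index k kE) nth_uniq // eq_sym.
have := pfw_insert T_skew i1 ltk; rewrite nth_index // addr0 => ->.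
by rewrite mulrCA signrMK mulrC.
Qed.

Lemma word_adj_out E y k : k \notin E -> word_adj E y k 0 = 0.
Proof.
move=> kE; rewrite summxE big1 // => i _; rewrite summxE big1 // => l _.
rewrite !mxE (negbTE (_ : k != _)) ?mulr0 //; apply: contraNneq kE => ->.
by apply: (@omit_subset _ i); rewrite mem_nth // size_omit.
Qed.

Lemma increasing_enum : increasing V.
Proof.
have := iota_ltn_sorted 0 n; rewrite -val_enum_ord sorted_map.
by apply: sub_sorted.
Qed.

Lemma regular_pfbar : new_letter_regular T ->
  [/\ u != 0, p1 != 0, nzdmod [:: u] p1 & nzdmod [:: u; p1] p2].
Proof.
move=> T_reg; have := increasing_enum; rewrite enumV => V_inc.
have [bW_inc _ _] := increasing_cons V_inc.
have [W_inc b_uniq _] := increasing_cons bW_inc.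
have W_odd : odd (size (i3 :: W)) by rewrite /= sizeW; lia.
have [] := regular_pfw T_reg W_inc W_odd; rewrite omit0 => u0 nz1 nz2; split=> //.
- by apply: (pfw_neq0_cons T_reg (i := 0)) => //; rewrite omit0.
- exact: nz1.
- exact: nz2.
Qed.

Hypotheses (u_neq0 : u != 0) (p1_neq0 : p1 != 0).

(** If T z = 0 with z supported on W, then pairing z with T times an adjugate
    vector gives u z_j on one side, and zero on the other since T is skew. *)
Lemma del3_inj : injective (mulmx (del3 T) : 'cV_(n - 3) -> 'cV_n).
Proof.
move=> z z' zz'; apply/eqP; rewrite -subr_eq0; apply/eqP.
have : T *m extend3 (z - z') = 0 by rewrite -del3E mulmxBr zz' subrr.
move: (z - z') => {zz' z'}z Tz; apply/matrixP => j j'; rewrite ord1 mxE.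
have Ttr : T^T = - T by apply/matrixP => i i'; rewrite !mxE T_skew.
have : (extend3 z)^T *m (T *m word_adj W (delta_mx (shift3 j) 0)) = 0.
  have zT : (extend3 z)^T *m T = - (T *m extend3 z)^T.
    by rewrite trmx_mul Ttr mulmxN opprK.
  by rewrite mulmxA zT Tz trmx0 oppr0 mul0mx.
move=> /matrixP/(_ 0 0); rewrite [RHS]mxE mxE (bigD1 (shift3 j)) //= big1.
  rewrite addr0 mulT_word_adj_in ?uniqW ?mem_W // !mxE !eqxx mulr1 -extend3_shift.
  by move/eqP; rewrite mulf_eq0 (negbTE u_neq0) orbF mxE => /eqP.
move=> i ij; have [lei|lti] := leqP i 2.
  by rewrite mxE extend3_low // mul0r.
by rewrite mulT_word_adj_in ?uniqW ?mem_W // [delta_mx _ _ _ _]mxE (negbTE ij) !mulr0.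
Qed.

Lemma mul_del2T r (z : 'cV_n) :
  (del2 T *m (T *m z)) r 0 = (del2 T *m T) r i1 * z i1 0 +
    ((del2 T *m T) r i2 * z i2 0 + (del2 T *m T) r i3 * z i3 0).
Proof.
rewrite mulmxA mxE sumV [X in _ + (_ + (_ + X))]big1 ?addr0 // => k _.
by rewrite del2T_W ?mul0r // val_nthW.
Qed.

(** The vector t = T z - u y is supported on i1, i2, i3 and del2 t = 0; on these
    coordinates del2 is u times the identity. *)
Lemma kill2_u (y : 'cV_n) : del2 T *m y = 0 -> exists z, del3 T *m z = u *: y.
Proof.
move=> y0; pose z := word_adj W y.
have z_low (i : 'I_n) : (i <= 2)%N -> z i 0 = 0.
  by move=> lei; rewrite word_adj_out // mem_W -leqNgt.
exists (restrict3 z); rewrite del3E restrict3K //.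
apply/eqP; rewrite -subr_eq0; apply/eqP; set t := _ - _.
have t_W (i : 'I_n) : (2 < i)%N -> t i 0 = 0.
  move=> lti; have -> : t i 0 = (T *m z) i 0 - u * y i 0 by rewrite !mxE.
  by rewrite mulT_word_adj_in ?uniqW ?mem_W // subrr.
have d2t r : (del2 T *m t) r 0 = 0.
  rewrite /t mulmxBr -scalemxAr y0 scaler0 subr0 mul_del2T.
  by rewrite !z_low // !mulr0 !addr0.
apply/matrixP => i j; rewrite ord1 [RHS]mxE.
have [lei|] := leqP i 2; last exact: t_W.
have ltr : (i < 4)%N by apply: leq_ltn_trans lei _.
have := d2t (Ordinal ltr); rewrite (@del2_row _ i) //.
rewrite big1 ?addr0 => [/eqP|k _]; last by rewrite t_W ?mulr0 // val_nthW.
by rewrite mulf_eq0 (negbTE u_neq0) => /eqP.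
Qed.

(** Here T z = p1 y holds in the row of i1 as well, by the last row of
    del2 y = 0. The coordinates z_i2 and z_i3 have to vanish for z to come from
    del3; this follows from del2 (T z) = p1 (del2 y) = 0. *)
Lemma kill2_p1 (y : 'cV_n) : del2 T *m y = 0 -> exists z, del3 T *m z = p1 *: y.
Proof.
move=> y0; pose E := [:: i2, i3 & W]; pose z := word_adj E y.
have [i1E uE] : i1 \notin E /\ uniq E.
  by have := enum_uniq 'I_n; rewrite -/V enumV => /andP[].
have TzE : T *m z = p1 *: y.
  apply/matrixP => k j; rewrite ord1 [RHS]mxE.
  have [kE|kE] := boolP (k \in E); first exact: mulT_word_adj_in.
  have ->: k = i1.
    apply/eqP; apply: contraR kE => k1; have := mem_enum 'I_n k.
    by rewrite -/V enumV in_cons (negbTE k1).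
  have := del2_row_last y; rewrite y0 mxE.
  under eq_bigr => l _ do rewrite -[X in y X](nth_ord_enum i1) -/V enumV.
  have sum_recl m m' (F : nat -> R) : m = m'.+1 ->
      \sum_(j < m) F j = F 0%N + \sum_(j < m') F j.+1.
    by move=> ->; rewrite big_ord_recl.
  have nE : n = (size E).+1 by rewrite /= sizeW; lia.
  rewrite (sum_recl _ _ (fun j => (-1) ^+ j * pf (omit j (i1 :: E)) *
    y (nth i1 (i1 :: E) j) 0) nE) omit0 mul1r /= => /esym/eqP.
  rewrite addrC addr_eq0 => /eqP sumE; rewrite mulT_word_adj -[RHS]opprK -sumE -sumrN.
  by apply: eq_bigr => i _; rewrite omitS exprS; ring.
have z1 : z i1 0 = 0 by apply: word_adj_out.
have d2Tz r : (del2 T *m (T *m z)) r 0 = 0.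
  by rewrite TzE -scalemxAr y0 scaler0 mxE.
have rowE (r : 'I_4) (i : 'I_n) : r = i :> nat -> (i < 3)%N ->
    pf [:: i2, i & W] * z i2 0 + pf [:: i3, i & W] * z i3 0 = 0.
  move=> ri lti; have := d2Tz r; rewrite mul_del2T z1 mulr0 add0r.
  rewrite !(del2T_row _ ri lti) !mulNr -opprD => /eqP.
  by rewrite oppr_eq0 => /eqP.
exists (restrict3 z); rewrite del3E restrict3K //.
have pf_swap a b : pf [:: a, b & W] = - pf [:: b, a & W] by apply: pfw_swap_front.
have pf_same a : pf [:: a, a & W] = 0 by apply: pf_rep; rewrite mem_head.
move=> i /ord_low[] -> //.
- have := rowE (inord 2) i3; rewrite inordK // => /(_ erefl isT).
  by rewrite pf_same mul0r addr0 => /eqP; rewrite mulf_eq0 (negbTE p1_neq0) => /eqP.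
- have := rowE 1 i2 erefl isT; rewrite pf_same mul0r add0r pf_swap mulNr => /eqP.
  by rewrite oppr_eq0 mulf_eq0 (negbTE p1_neq0) => /eqP.
Qed.

Lemma ord4_ind (P : 'I_4 -> Prop) :
  P 0 -> P 1 -> P (inord 2) -> P ord_max -> forall r, P r.
Proof.
move=> P0 P1 P2 P3 [[|[|[|[|//]]]] ltr].
- by rewrite (_ : Ordinal ltr = 0) //; apply: val_inj.
- by rewrite (_ : Ordinal ltr = 1) //; apply: val_inj.
- by rewrite (_ : Ordinal ltr = inord 2) //; apply: val_inj; rewrite /= inordK.
- by rewrite (_ : Ordinal ltr = ord_max) //; apply: val_inj.
Qed.

(** The image of del2 contains its own first three columns and those of
    del2 * T, which are the Koszul-like relations between p1, p2 and p3. *)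
Lemma del2_image (a1 a2 a3 b1 b2 b3 : R) (y : 'cV_4) :
    y 0 0 = a1 * u + b2 * p3 + b3 * p2 ->
    y 1 0 = a2 * u - b1 * p3 + b3 * p1 ->
    y (inord 2) 0 = a3 * u - b1 * p2 - b2 * p1 ->
    y ord_max 0 = a1 * p1 - a2 * p2 + a3 * p3 ->
  exists z, del2 T *m z = y.
Proof.
move=> y0 y1 y2 y3; pose e i : 'cV[R]_n := delta_mx i 0.
exists (a1 *: e i1 + a2 *: e i2 + a3 *: e i3 +
  (b1 *: col i1 T + b2 *: col i2 T + b3 *: col i3 T)).
have colE r : (del2 T *m (a1 *: e i1 + a2 *: e i2 + a3 *: e i3 +
      (b1 *: col i1 T + b2 *: col i2 T + b3 *: col i3 T))) r 0 =
    a1 * del2 T r i1 + a2 * del2 T r i2 + a3 * del2 T r i3 +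
    (b1 * (del2 T *m T) r i1 + b2 * (del2 T *m T) r i2 + b3 * (del2 T *m T) r i3).
  rewrite !del2T_col; set c1 := col i1 T; set c2 := col i2 T; set c3 := col i3 T.
  have addE (A B : 'cV[R]_4) : (A + B) r 0 = A r 0 + B r 0 by rewrite mxE.
  have scaleE a (A : 'cV[R]_4) : (a *: A) r 0 = a * A r 0 by rewrite mxE.
  have eE i : (del2 T *m e i) r 0 = del2 T r i by rewrite /e -colE mxE.
  by rewrite !mulmxDr -!scalemxAr !addE !scaleE !eE.
have swap a b : pf [:: a, b & W] = - pf [:: b, a & W] by apply: pfw_swap_front.
have same a : pf [:: a, a & W] = 0 by apply: pf_rep; rewrite mem_head.
have [l1 l2 l3] := del2_last_low.
have E2 : (inord 2 : 'I_4) = 2%N :> nat by rewrite inordK.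
apply/matrixP => r j; rewrite ord1 {j}; elim/ord4_ind: r; rewrite colE.
- rewrite !(@del2_low 0 i1) // !(@del2T_row 0 i1) // y0 same (swap i2) (swap i3) /=.
  by rewrite -/p2 -/p3; ring.
- rewrite !(@del2_low 1 i2) // !(@del2T_row 1 i2) // y1 same (swap i3) /=.
  by rewrite -/p1 -/p3; ring.
- rewrite !(@del2_low _ i3 _ E2) // !(@del2T_row _ i3 _ E2) // y2 same /=.
  by rewrite -/p1 -/p2; ring.
- by rewrite l1 l2 l3 !del2T_last y3; ring.
Qed.

Lemma kill1_u (y : 'cV_4) : del1 T *m y = 0 -> exists z, del2 T *m z = u *: y.
Proof.
move=> /matrixP/(_ 0 0); rewrite del1_mul [RHS]mxE => y0.
apply: (@del2_image (y 0 0) (y 1 0) (y (inord 2) 0) 0 0 0); rewrite !mxE; try by ring.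
apply/eqP; rewrite -subr_eq0 -y0; apply/eqP; ring.
Qed.

Lemma kill1_p1 (y : 'cV_4) : del1 T *m y = 0 -> exists z, del2 T *m z = p1 *: y.
Proof.
move=> /matrixP/(_ 0 0); rewrite del1_mul [RHS]mxE => y0.
apply: (@del2_image (y ord_max 0) 0 0 0 (- y (inord 2) 0) (y 1 0));
  rewrite !mxE; try by ring.
apply/eqP; rewrite eq_sym -subr_eq0 -y0; apply/eqP; ring.
Qed.

Lemma kill1_p2 (y : 'cV_4) : del1 T *m y = 0 -> exists z, del2 T *m z = p2 *: y.
Proof.
move=> /matrixP/(_ 0 0); rewrite del1_mul [RHS]mxE => y0.
apply: (@del2_image 0 (- y ord_max 0) 0 (- y (inord 2) 0) 0 (y 0 0));
  rewrite !mxE; try by ring.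
apply/eqP; rewrite -subr_eq0 -y0; apply/eqP; ring.
Qed.

Hypotheses (p1_nzd : nzdmod [:: u] p1) (p2_nzd : nzdmod [:: u; p1] p2).

Lemma skew_exact2 : exact_at (mulmx (del3 T) : 'cV_(n - 3) -> 'cV_n) (mulmx (del2 T)).
Proof.
apply: (acyclic2 u_neq0 p1_nzd del3_inj del2_del3) => a.
by rewrite !inE => /orP[] /eqP ->; [apply: kill2_u | apply: kill2_p1].
Qed.

Lemma skew_exact1 : exact_at (mulmx (del2 T) : 'cV_n -> 'cV_4) (mulmx (del1 T)).
Proof.
apply: (acyclic1 u_neq0 p1_nzd p2_nzd del3_inj del2_del3 del1_del2) => a.
  by rewrite !inE => /orP[] /eqP ->; [apply: kill2_u | apply: kill2_p1].
rewrite !inE => /or3P[] /eqP ->; [exact: kill1_u | exact: kill1_p1 | exact: kill1_p2].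
Qed.

End Complex.

(** * Grade and projective dimension of the quotient *)

Section QuotientGrade.

Variable R : comNzRingType.
Implicit Types (s : seq R).

Lemma genideal_natP s r :
  r \in genideal s <-> exists c : nat -> R, r = \sum_(i < size s) c i * s`_i.
Proof.
split=> [/genidealP[c ->]|[c ->]]; last by apply/genidealP; exists (fun i => c i).
exists (fun i => if insub i is Some j then c j else 0).
by apply: eq_bigr => i _; rewrite valK.
Qed.

Lemma genideal_takeP s i r : (i <= size s)%N ->
  r \in genideal (take i s) <-> in_multiples (nth 0 s) i (r : R^o).
Proof.
move=> leis; rewrite genideal_natP size_takel //.
by split=> -[c ->]; exists c; apply: eq_bigr => l _; rewrite ?nth_take //;
  rewrite mulrC.
Qed.

Lemma genideal_imageP m (F : 'I_m -> R) r :
  r \in genideal [seq F j | j : 'I_m] <-> exists y : 'cV[R]_m, r = \sum_j F j * y j 0.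
Proof.
have szF : size [seq F j | j : 'I_m] = m by rewrite size_image card_ord.
have nthF (j : 'I_m) : [seq F j | j : 'I_m]`_j = F j.
  by rewrite (nth_map j) ?size_enum_ord // nth_ord_enum.
rewrite genideal_natP szF; split=> [[c ->]|[y ->]].
  by exists (\col_j c j); apply: eq_bigr => j _; rewrite nthF mxE mulrC.
exists (fun i => if insub i is Some j then y j 0 else 0).
by apply: eq_bigr => i _; rewrite valK nthF mulrC.
Qed.

Lemma quotmod_kill s a (y : quotmod s) : a \in genideal s -> a *: y = 0.
Proof.
move=> as_; have [r <-] := quotproj_surj y.
rewrite [LHS]quotscaleE -(quotproj0 s); apply/quotproj_eq.
by rewrite subr0 mulrC genidealM.
Qed.

Lemma quotproj1_neq0 s : 1 \notin genideal s -> quotproj s 1 <> 0.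
Proof.
move=> /negP s1; rewrite -(quotproj0 s) => /quotproj_eq.
by rewrite subr0.
Qed.

Lemma regular_size_le_pdim s t k : 1 \notin genideal s ->
  regular_seq t -> {subset t <= genideal s} -> pdim_le (quotmod s) k ->
  (size t <= k)%N.
Proof.
move=> s1 [_ t_reg] ts [P [d [e [P_proj P0 e_surj ex0 exS]]]].
apply: (@regular_length_le_pdim R (nth 0 t) (size t) _ (quotmod s) P d e) => //.
- move=> i ltit r; rewrite -!genideal_takeP 1?ltnW // => /= xr.
  by apply: t_reg => //; rewrite mulrC.
- by move=> i ltit y; apply/quotmod_kill/ts/mem_nth.
- by exists (quotproj s 1); apply: quotproj1_neq0.
Qed.

Lemma augmentation_is_linear s : linear (@augmentation R s).
Proof.
move=> a y z; rewrite /augmentation !mxE quotprojD; congr (_ + _).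
exact/esym/quotscaleE.
Qed.

HB.instance Definition _ s := GRing.isLinear.Build R 'cV[R]_1 (quotmod s) *:%R
  (@augmentation R s) (@augmentation_is_linear s).

Lemma augmentation_surj s u : exists v, @augmentation R s v = u.
Proof.
by have [x <-] := quotproj_surj u; exists x%:M; rewrite /augmentation mxE mulr1n.
Qed.

Lemma augmentation_exact m (A : 'M[R]_(1, m)) :
  exact_at (mulmx A : 'cV_m -> 'cV_1) (@augmentation R [seq A 0 j | j : 'I_m]).
Proof.
move=> v; rewrite /augmentation.
have -> : quotproj [seq A 0 j | j : 'I_m] (v 0 0) = 0 <->
    v 0 0 \in genideal [seq A 0 j | j : 'I_m].
  by rewrite -(quotproj0 _) quotproj_eq subr0.
rewrite genideal_imageP; split=> -[y yE]; exists y.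
  by apply/matrixP => i j; rewrite !ord1 yE mxE.
by rewrite -yE mxE.
Qed.

Section Length3.

Variables (b3 b2 b1 : nat).
Variables (D3 : 'M[R]_(b2, b3)) (D2 : 'M[R]_(b1, b2)) (D1 : 'M[R]_(1, b1)).

Definition rank3 i :=
  match i with 0 => 1%N | 1 => b1 | 2 => b2 | 3 => b3 | _ => 0%N end.

Definition diff3 i : 'M[R]_(rank3 i, rank3 i.+1) :=
  match i with 0 => D1 | 1 => D2 | 2 => D3 | _ => 0 end.

Lemma pdim_le3 (gens := [seq D1 0 j | j : 'I_b1]) :
    injective (mulmx D3 : 'cV_b3 -> 'cV_b2) ->
    exact_at (mulmx D3 : 'cV_b3 -> 'cV_b2) (mulmx D2) ->
    exact_at (mulmx D2 : 'cV_b2 -> 'cV_b1) (mulmx D1) ->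
  pdim_le (quotmod gens) 3.
Proof.
move=> inj3 ex2 ex1.
exists (fun i => 'cV[R]_(rank3 i) : lmodType R).
exists (fun i => mulmx (diff3 i) : {linear 'cV_(rank3 i.+1) -> 'cV_(rank3 i)}).
exists (@augmentation R gens : {linear 'cV_1 -> quotmod gens}); split.
- by move=> i; apply: projective_cV.
- by move=> [|[|[|[|i]]]] // _ x; apply/matrixP => -[].
- exact: augmentation_surj.
- exact: augmentation_exact.
move=> [|[|[|i]]] //=.
- move=> y; split=> [|[x <-]]; last by rewrite mul0mx mulmx0.
  by rewrite -[X in _ = X](mulmx0 _ D3) => /inj3 ->; exists 0; rewrite mulmx0.
- move=> y; split=> [_|_]; last exact: mul0mx.
  by exists 0; apply/matrixP => -[].
Qed.

End Length3.

Lemma genideal_rmorph0 (S : nzRingType) (f : {rmorphism R -> S}) s r :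
  (forall a, a \in s -> f a = 0) -> r \in genideal s -> f r = 0.
Proof.
move=> fs /genidealP[c ->]; rewrite rmorph_sum big1 // => i _.
by rewrite rmorphM (fs s`_i) ?mulr0 ?mem_nth.
Qed.

End QuotientGrade.

(** Pfaffians of nonempty words have no constant term; hence the ideal is
    proper. *)
Lemma meval0_pfw n (w : seq 'I_n) : (0 < size w)%N ->
  meval (fun=> 0) (pfw (genskew n) w) = 0.
Proof.
case: w => // a w _.
rewrite (pfw_cons _ a) rmorph_sum big1 // => k _.
have tau0 (i j : 'I_n) : meval (fun=> 0) (tau i j) = 0.
  by rewrite /tau; case: insub => [p|]; rewrite ?mevalXU ?meval0.
by rewrite !rmorphM /= mxE rmorphB /= !tau0 subrr mul0r mulr0.
Qed.

Theorem theorem2p3 (n : nat) (hn : (5 <= n)%N) (hodd : odd n) :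
  let T : 'M[tauring n]_n := genskew n in
  let d3 : 'cV[tauring n]_(n - 3) -> 'cV[tauring n]_n := mulmx (del3 T) in
  let d2 : 'cV[tauring n]_n -> 'cV[tauring n]_4 := mulmx (del2 T) in
  let d1 : 'cV[tauring n]_4 -> 'cV[tauring n]_1 := mulmx (del1 T) in
  let gens : seq (tauring n) := [seq del1 T 0 j | j : 'I_4] in
  [/\ injective d3, exact_at d3 d2 & exact_at d2 d1] /\
  (exact_at d1 (augmentation gens) /\
   forall u : quotmod gens, exists v, augmentation gens v = u) /\
  perfect_of_grade gens 3.
Proof.
move=> T d3 d2 d1 gens.
have n_gt2 : (2 < n)%N by apply: leq_trans hn.
have T_skew : forall i j, T j i = - T i j by apply: genskew_skew.
have T_diag : forall i, T i i = 0 by apply: genskew_diag.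
have [u0 p10 nz1 nz2] := regular_pfbar n_gt2 hodd (@genskew_new_letter n).
have inj3 : injective d3 by apply: del3_inj T_skew T_diag u0.
have ex2 : exact_at d3 d2.
  exact: (skew_exact2 hodd T_skew T_diag u0 p10 nz1).
have ex1 : exact_at d2 d1.
  exact: (skew_exact1 hodd T_skew T_diag u0 p10 nz1 nz2).
have pd3 : pdim_le (quotmod gens) 3 := pdim_le3 inj3 ex2 ex1.
pose p1 := pfbar T [:: 1%N]; pose p2 := pfbar T [:: 2%N]; pose p3 := pfbar T [:: 3%N].
pose u := pfbar T [:: 1; 2; 3]%N.
have [E0 E1 E2 E3] : [/\ del1 T 0 0 = - p1, del1 T 0 1 = p2,
    del1 T 0 (inord 2) = - p3 & del1 T 0 ord_max = u].
  by rewrite !mxE /= inordK.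
have gens_mem j : del1 T 0 j \in genideal gens by apply/genideal_mem/image_f.
have eval_pf : [/\ meval (fun=> 0) p1 = 0, meval (fun=> 0) p2 = 0,
    meval (fun=> 0) p3 = 0 & meval (fun=> 0) u = 0].
  rewrite /p1 /p2 /p3 /u (pfbar1 T n_gt2 hodd) (pfbar2 T n_gt2 hodd).
  rewrite (pfbar3 T n_gt2 hodd) (pfbar123 T n_gt2 hodd).
  split; apply: meval0_pfw; try exact: isT.
  by rewrite size_map size_enum_ord subn_gt0 (leq_trans _ hn).
have eval_gens a : a \in genideal gens -> meval (fun=> 0) a = 0.
  apply: genideal_rmorph0 => _ /imageP[j _ ->]; case: eval_pf => e1 e2 e3 e4.
  by elim/ord4_ind: j; rewrite ?E0 ?E1 ?E2 ?E3 ?rmorphN /= ?e1 ?e2 ?e3 ?e4 ?oppr0.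
have gens1 : 1 \notin genideal gens.
  by apply/negP => /eval_gens/eqP; rewrite meval1 oner_eq0.
pose t := [:: u; p1; p2].
have t_gens : {subset t <= genideal gens}.
  move=> a; rewrite !inE => /or3P[] /eqP ->; first by rewrite -E3.
    by rewrite -[p1]opprK -E0 rpredN.
  by rewrite -E1.
have t_reg : regular_seq t.
  split.
    apply/negP => t1; have : meval (fun=> 0) (1 : tauring n) = 0.
      by apply: genideal_rmorph0 t1 => a at_; apply/eval_gens/t_gens.
    by rewrite meval1 => /eqP; rewrite oner_eq0.
  move: u0 p10 nz1 nz2.
  rewrite -(pfbar123 T n_gt2 hodd) -(pfbar1 T n_gt2 hodd) -(pfbar2 T n_gt2 hodd).
  move=> u0 p10 nz1 nz2.
  case=> [_|[_|[_|i //]]]; [exact: nzdmod_nil u0 | exact: nz1 | exact: nz2].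
split; first by [].
split; first by split; [exact: augmentation_exact | exact: augmentation_surj].
split=> //; split.
- by exists t.
- by move=> s s_reg s_gens; apply: regular_size_le_pdim pd3.
- exact: pd3.
- by move=> k; apply: (regular_size_le_pdim (t := t)).
Qed.
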